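(* Let $M$ be a closed connected smooth manifold and let $\gamma_1,\dots,\gamma_n$ be $n$ pairwise disjoint, smooth, coorientable, null-homologous, embedded loops in $M$. Then there is an infinite-dimensional space (in the sense specified in the context) of pairs of Riemannian metrics $g$ and one-forms $\alpha$ on $M$ such that each of the loops $\gamma_1,\dots,\gamma_n$ is a magnetic geodesic of strong geodesic type of the exact magnetic system $(M,g,\mathrm d\alpha)$. In particular, $(M,g,\mathrm d\alpha)$ is of strong geodesic type. As a consequence, for every energy value $\kappa\in(0,\infty)$ the magnetic geodesic flow $\Phi^t_{g,\mathrm d\alpha}$ admits at least $n$ null-homologous embedded periodic orbits of energy $\kappa$, which have non-positive action whenever $\kappa\in(0,c_0(M,g,\mathrm d\alpha)]$.
   Context: A smooth embedded loop is a smooth embedding $\gamma:\mathbb R/T\mathbb Z\to M$, $T>0$. It is coorientable if $\gamma^*TM$ is orientable, and null-homologous if its class in $H_1(M)$ vanishes. For a Riemannian metric $g$ and one-form $\alpha$ on $M$, a smooth embedded loop $\gamma$ is a magnetic geodesic of strong geodesic type of $(M,g,\mathrm d\alpha)$ if: $\gamma$ is coorientable and null-homologous; $\gamma$ is a geodesic of $(M,g)$; $\mathrm d\alpha_{\gamma(t)}(\dot\gamma(t),\cdot)=0$ for all $t$; (maximality) $|\alpha_{\gamma(t)}|_g=\max_{x\in M}|\alpha_x|_g$ for all $t$; and $g_{\gamma(t)}(\dot\gamma(t),v)=\alpha_{\gamma(t)}(v)$ for all $t$ and all $v\in T_{\gamma(t)}M$. The exact magnetic system $(M,g,\mathrm d\alpha)$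 is of strong geodesic type if it admits such a loop. The Lorentz force $Y$ is defined by $g_q(Y_qu,v)=\mathrm d\alpha_q(u,v)$; magnetic geodesics are the smooth curves with $\nabla_{\dot\gamma}\dot\gamma=Y_\gamma\dot\gamma$; $\Phi^t_{g,\mathrm d\alpha}$ is the corresponding flow on $TM$, and the energy is the constant $\frac12g(\dot\gamma,\dot\gamma)$. Adjectives such as embedded and null-homologous for periodic orbits refer to the projected loop in $M$. With $L(q,v)=\frac12|v|_g^2-\alpha_q(v)$ and $S_{L+\kappa}(\gamma)=\int_0^T(L(\gamma,\dot\gamma)+\kappa)\,\mathrm dt$ for $\gamma\in C^\infty(\mathbb R/T\mathbb Z,M)$, the action of a periodic magnetic geodesic of energy $\kappa$ is $S_{L+\kappa}(\gamma)$, and $c_0(M,g,\mathrm d\alpha)=\inf\{\kappa\in\mathbb R:S_{L+\kappa}(\gamma)\ge0\ \forall T>0,\ \forall \gamma\in C^\infty(\mathbb R/T\mathbb Z,M)\text{ homologous to zero}\}$. ''Infinite-dimensional space'' means: such a pair $(g,\alpha)$ exists, and $g$ and $\alpha$ are prescribed only in a small neighbourhood of the loops, while outside they may be chosen arbitrarily subject to maximality. That is, for every (arbitrarily small) open neighbourhood $U$ of $\bigcup_i\gamma_i$, every pair $(g',\alpha')$ that agrees with $(g,\alpha)$ on $U$ and for which $|\alpha'|_{g'}$ attains its maximum over $M$ along each $\gamma_i$ also has the stated properties. *)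

(* Defs.v *)
From HB Require Import structures.
From mathcomp Require Import all_boot all_order all_algebra.
From mathcomp Require Import all_classical all_reals all_analysis.

Set Implicit Arguments.
Unset Strict Implicit.
Unset Printing Implicit Defensive.

Import Order.TTheory GRing.Theory Num.Theory.
Import numFieldNormedType.Exports.

Local Open Scope classical_set_scope.
Local Open Scope ring_scope.

(* Used on open sets O of a finite-dimensional space V only.  There, requiring
   this for all [k] is the usual notion of a C^oo map: every iterated
   directional derivative exists and is differentiable. *)
Fixpoint Ck_on (R : realType) (V W : normedModType R) (k : nat)
    (O : set V) (f : V -> W) : Prop :=
  match k with
  | 0 => forall x, O x -> {for x, continuous f}
  | k'.+1 => (forall x, O x -> differentiable f x) /\
             (forall v, Ck_on k' O ('D_v f))
  end.

Definition smooth_on (R : realType) (V W : normedModType R)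
    (O : set V) (f : V -> W) : Prop := forall k, Ck_on k O f.

(* The maps [chart i] and [chart_inv i] are total functions; their values
   outside [chart_dom i] and its image are irrelevant.  The field [chart_at]
   singles out one chart around each point; it only serves to write tangent
   vectors at [x] as coordinate vectors. *)
Record smooth_atlas (R : realType) (m : nat) (M : topologicalType) := {
  chart_index : Type ;
  chart_dom : chart_index -> set M ;
  chart : chart_index -> M -> 'rV[R]_m ;
  chart_inv : chart_index -> 'rV[R]_m -> M ;
  chart_at : M -> chart_index ;
  chart_at_dom : forall x, chart_dom (chart_at x) x ;
  chart_dom_open : forall i, open (chart_dom i) ;
  chart_img_open : forall i, open (chart i @` chart_dom i) ;
  chartK : forall i x, chart_dom i x -> chart_inv i (chart i x) = x ;
  chart_continuous : forall i x,
    chart_dom i x -> {for x, continuous (chart i)} ;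
  chart_inv_continuous : forall i x,
    chart_dom i x -> {for chart i x, continuous (chart_inv i)} ;
  transition_smooth : forall i j,
    smooth_on (chart i @` (chart_dom i `&` chart_dom j))
              (chart j \o chart_inv i) }.

(* Without boundary, since charts have open images in R^m; second countability
   follows from compactness. *)
Definition closed_connected_manifold (R : realType) (m : nat)
    (M : topologicalType) (A : smooth_atlas R m M) : Prop :=
  [/\ hausdorff_space M, compact [set: M] & connected [set: M]].

(* Vectors are rows: a tangent vector at [x] with coordinates [u] in the chart
   [i] has coordinates [u *m transition_jac i j x] in the chart [j]. *)
Definition transition_jac (R : realType) (m : nat) (M : topologicalType)
    (A : smooth_atlas R m M) (i j : chart_index A) (x : M) : 'M[R]_m :=
  jacobian (chart j \o chart_inv i) (chart i x).

Definition smooth_in_chart (R : realType) (m : nat) (M : topologicalType)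
    (A : smooth_atlas R m M) (i : chart_index A) (f : M -> R) : Prop :=
  @smooth_on R 'rV[R]_m R^o (chart i @` chart_dom i) (f \o chart_inv i).

Definition partial (R : realType) (m : nat) (M : topologicalType)
    (A : smooth_atlas R m M) (i : chart_index A) (k : 'I_m)
    (f : M -> R) (x : M) : R :=
  'D_(delta_mx ord0 k) (f \o chart_inv i : 'rV[R]_m -> R^o) (chart i x).

(* Tensor fields are given by their components in every chart, related by the
   transformation law; components outside the chart domain are irrelevant. *)
Record riemannian_metric (R : realType) (m : nat) (M : topologicalType)
    (A : smooth_atlas R m M) := {
  metric_coef : chart_index A -> M -> 'M[R]_m ;
  metric_smooth : forall i k l,
    smooth_in_chart i (fun x => metric_coef i x k l) ;
  metric_sym : forall i x, chart_dom i x ->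
    (metric_coef i x)^T = metric_coef i x ;
  metric_posdef : forall i x, chart_dom i x -> forall u : 'rV[R]_m,
    u != 0 -> 0 < (u *m metric_coef i x *m u^T) ord0 ord0 ;
  metric_transform : forall i j x, chart_dom i x -> chart_dom j x ->
    metric_coef i x =
      transition_jac i j x *m metric_coef j x *m (transition_jac i j x)^T }.

Record one_form (R : realType) (m : nat) (M : topologicalType)
    (A : smooth_atlas R m M) := {
  form_coef : chart_index A -> M -> 'rV[R]_m ;
  form_smooth : forall i k,
    smooth_in_chart i (fun x => form_coef i x ord0 k) ;
  form_transform : forall i j x, chart_dom i x -> chart_dom j x ->
    form_coef i x = form_coef j x *m (transition_jac i j x)^T }.

(* From here on a tangent vector at [x] is the row of its coordinates in the
   chart [chart_at A x]. *)
Definition metric_at (R : realType) (m : nat) (M : topologicalType)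
    (A : smooth_atlas R m M) (g : riemannian_metric A) (x : M)
    (u v : 'rV[R]_m) : R :=
  (u *m metric_coef g (chart_at A x) x *m v^T) ord0 ord0.

Definition form_at (R : realType) (m : nat) (M : topologicalType)
    (A : smooth_atlas R m M) (a : one_form A) (x : M) (v : 'rV[R]_m) : R :=
  (form_coef a (chart_at A x) x *m v^T) ord0 ord0.

(* the norm of the covector [a_x] for the inverse metric *)
Definition form_norm (R : realType) (m : nat) (M : topologicalType)
    (A : smooth_atlas R m M) (g : riemannian_metric A) (a : one_form A)
    (x : M) : R :=
  let i := chart_at A x in
  Num.sqrt ((form_coef a i x *m invmx (metric_coef g i x)
               *m (form_coef a i x)^T) ord0 ord0).

Definition dform_coef (R : realType) (m : nat) (M : topologicalType)
    (A : smooth_atlas R m M) (a : one_form A) (i : chart_index A) (x : M) :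
    'M[R]_m :=
  \matrix_(k, l) (partial i k (fun y => form_coef a i y ord0 l) x
                  - partial i l (fun y => form_coef a i y ord0 k) x).

Definition dform_at (R : realType) (m : nat) (M : topologicalType)
    (A : smooth_atlas R m M) (a : one_form A) (x : M) (u v : 'rV[R]_m) : R :=
  (u *m dform_coef a (chart_at A x) x *m v^T) ord0 ord0.

(* The Lorentz force Y; its defining identity is [lorentz_atP] below. *)
Definition lorentz_at (R : realType) (m : nat) (M : topologicalType)
    (A : smooth_atlas R m M) (g : riemannian_metric A) (a : one_form A)
    (x : M) (u : 'rV[R]_m) : 'rV[R]_m :=
  u *m dform_coef a (chart_at A x) x *m invmx (metric_coef g (chart_at A x) x).

Lemma metric_coef_unit (R : realType) (m : nat) (M : topologicalType)
    (A : smooth_atlas R m M) (g : riemannian_metric A) (i : chart_index A)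
    (x : M) : chart_dom i x -> metric_coef g i x \in unitmx.
Proof.
move=> xi; rewrite -row_free_unit -kermx_eq0; apply/eqP/row_matrixP => k.
rewrite row0; apply/eqP/negPn/negP => /(metric_posdef g xi).
have /sub_kermxP -> := row_sub k (kermx (metric_coef g i x)).
by rewrite mul0mx mxE ltxx.
Qed.

Lemma lorentz_atP (R : realType) (m : nat) (M : topologicalType)
    (A : smooth_atlas R m M) (g : riemannian_metric A) (a : one_form A)
    (x : M) (u v : 'rV[R]_m) :
  metric_at g x (lorentz_at g a x u) v = dform_at a x u v.
Proof.
rewrite /metric_at /lorentz_at -[X in (X *m _) _ _]mulmxA mulVmx ?mulmx1 //.
exact/metric_coef_unit/chart_at_dom.
Qed.

(* [christoffel g i x a b k] is Gamma^k_{ab} at [x] in the chart [i]. *)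
Definition christoffel (R : realType) (m : nat) (M : topologicalType)
    (A : smooth_atlas R m M) (g : riemannian_metric A) (i : chart_index A)
    (x : M) (a b k : 'I_m) : R :=
  2^-1 * \sum_(l < m) invmx (metric_coef g i x) k l *
    (partial i a (fun y => metric_coef g i y b l) x
     + partial i b (fun y => metric_coef g i y a l) x
     - partial i l (fun y => metric_coef g i y a b) x).

Definition smooth_curve (R : realType) (m : nat) (M : topologicalType)
    (A : smooth_atlas R m M) (c : R -> M) : Prop :=
  continuous c /\
  forall i : chart_index A,
    @smooth_on R R^o 'rV[R]_m [set t | chart_dom i (c t)] (chart i \o c).

Definition velocity (R : realType) (m : nat) (M : topologicalType)
    (A : smooth_atlas R m M) (c : R -> M) (t : R) : 'rV[R]_m :=
  derive1 (chart (chart_at A (c t)) \o c) t.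

(* the Levi-Civita covariant derivative of the velocity along the curve *)
Definition covariant_acceleration (R : realType) (m : nat)
    (M : topologicalType) (A : smooth_atlas R m M) (g : riemannian_metric A)
    (c : R -> M) (t : R) : 'rV[R]_m :=
  let i := chart_at A (c t) in
  let v := velocity A c t in
  \row_k (derive1n 2 (chart i \o c) t ord0 k
          + \sum_(a < m) \sum_(b < m)
              christoffel g i (c t) a b k * v ord0 a * v ord0 b).

Definition geodesic (R : realType) (m : nat) (M : topologicalType)
    (A : smooth_atlas R m M) (g : riemannian_metric A) (c : R -> M) : Prop :=
  smooth_curve A c /\ forall t, covariant_acceleration g c t = 0.

Definition magnetic_geodesic (R : realType) (m : nat) (M : topologicalType)
    (A : smooth_atlas R m M) (g : riemannian_metric A) (a : one_form A)
    (c : R -> M) : Prop :=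
  smooth_curve A c /\
  forall t, covariant_acceleration g c t
            = lorentz_at g a (c t) (velocity A c t).

Definition has_energy (R : realType) (m : nat) (M : topologicalType)
    (A : smooth_atlas R m M) (g : riemannian_metric A) (kappa : R)
    (c : R -> M) : Prop :=
  forall t, 2^-1 * metric_at g (c t) (velocity A c t) (velocity A c t) = kappa.

(* A loop R/TZ -> M is represented by a [T]-periodic curve R -> M. *)
Definition smooth_loop (R : realType) (m : nat) (M : topologicalType)
    (A : smooth_atlas R m M) (T : R) (c : R -> M) : Prop :=
  [/\ 0 < T, smooth_curve A c & forall t, c (t + T) = c t].

(* An injective immersion of R/TZ which is a homeomorphism onto its image. *)
Definition embedded_loop (R : realType) (m : nat) (M : topologicalType)
    (A : smooth_atlas R m M) (T : R) (c : R -> M) : Prop :=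
  [/\ smooth_loop A T c,
      forall t, velocity A c t != 0,
      forall s t, c s = c t -> exists k : int, s = t + k%:~R * T
    & forall (t e : R), 0 < e -> \forall y \near c t,
        forall s, c s = y -> exists k : int, `|s - (t + k%:~R * T)| < e].

(* [o i t] tells whether the orientation chosen on the tangent space at [c t]
   is the one of the coordinates of the chart [i]. *)
Definition coorientable (R : realType) (m : nat) (M : topologicalType)
    (A : smooth_atlas R m M) (T : R) (c : R -> M) : Prop :=
  exists o : chart_index A -> R -> bool,
  [/\ forall i t, chart_dom i (c t) -> o i (t + T) = o i t,
      forall i j t, chart_dom i (c t) -> chart_dom j (c t) ->
        o j t = (\det (transition_jac i j (c t)) < 0) (+) o i t
    & forall i t, chart_dom i (c t) -> \forall s \near t, o i s = o i t].

Definition std_simplex (R : realType) (p : nat) : set 'rV[R]_p.+1 :=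
  [set x | (forall i, 0 <= x ord0 i) /\ \sum_i x ord0 i = 1].

(* Singular [p]-simplices are total functions, only their restriction to the
   standard simplex matters. *)
Definition singular_simplex (R : realType) (M : topologicalType) (p : nat)
    (s : 'rV[R]_p.+1 -> M) : Prop := {within @std_simplex R p, continuous s}.

Definition same_simplex (R : realType) (M : topologicalType) (p : nat)
    (s s' : 'rV[R]_p.+1 -> M) : bool :=
  `[< forall x, @std_simplex R p x -> s x = s' x >].

Definition face (R : realType) (M : topologicalType) (p : nat) (k : 'I_p.+2)
    (s : 'rV[R]_p.+2 -> M) : 'rV[R]_p.+1 -> M :=
  fun x => s (\row_j (if unlift k j is Some j' then x ord0 j' else 0)).

Definition loop_simplex (R : realType) (M : topologicalType) (T : R)
    (c : R -> M) : 'rV[R]_2 -> M := fun x => c (T * x ord0 ord_max).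

(* Vanishing in H_1(M; Z): the loop, seen as a singular 1-cycle, is the boundary of the 2-chain
   sum_j z_j s_j: for every 1-simplex [tau], both sides have the same
   coefficient on [tau]. *)
Definition null_homologous (R : realType) (M : topologicalType) (T : R)
    (c : R -> M) : Prop :=
  exists (N : nat) (z : 'I_N -> int) (s : 'I_N -> ('rV[R]_3 -> M)),
    (forall j, singular_simplex (s j)) /\
    forall tau : 'rV[R]_2 -> M, singular_simplex tau ->
      \sum_(j < N) z j *
        (\sum_(k < 3) (-1) ^+ k * (same_simplex (face k (s j)) tau)%:R)
      = (same_simplex (loop_simplex T c) tau)%:R :> int.

(* S_{L+kappa} for L(q,v) = |v|^2/2 - alpha_q(v) *)
Definition action (R : realType) (m : nat) (M : topologicalType)
    (A : smooth_atlas R m M) (g : riemannian_metric A) (a : one_form A)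
    (kappa T : R) (c : R -> M) : R :=
  \int[lebesgue_measure]_(t in `[0, T])
    (2^-1 * metric_at g (c t) (velocity A c t) (velocity A c t)
     - form_at a (c t) (velocity A c t) + kappa).

(* [inf] is real-valued.  For M closed and non-empty the set is non-empty, and
   it is bounded below by 0 because of the constant loops. *)
Definition c0 (R : realType) (m : nat) (M : topologicalType)
    (A : smooth_atlas R m M) (g : riemannian_metric A) (a : one_form A) : R :=
  inf [set kappa : R | forall (T : R) (c : R -> M),
         smooth_loop A T c -> null_homologous T c ->
         0 <= action g a kappa T c].

Definition maximal_along (R : realType) (m : nat) (M : topologicalType)
    (A : smooth_atlas R m M) (g : riemannian_metric A) (a : one_form A)
    (c : R -> M) : Prop :=
  forall (t : R) (x : M), form_norm g a x <= form_norm g a (c t).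

Record strong_geodesic_loop (R : realType) (m : nat) (M : topologicalType)
    (A : smooth_atlas R m M) (g : riemannian_metric A) (a : one_form A)
    (T : R) (c : R -> M) : Prop := {
  sg_embedded : embedded_loop A T c ;
  sg_coorientable : coorientable A T c ;
  sg_null_homologous : null_homologous T c ;
  sg_geodesic : geodesic g c ;
  sg_dform : forall t (v : 'rV[R]_m), dform_at a (c t) (velocity A c t) v = 0 ;
  sg_maximal : maximal_along g a c ;
  sg_dual : forall t (v : 'rV[R]_m),
    metric_at g (c t) (velocity A c t) v = form_at a (c t) v }.

Definition strong_geodesic_type (R : realType) (m : nat)
    (M : topologicalType) (A : smooth_atlas R m M) (g : riemannian_metric A)
    (a : one_form A) : Prop :=
  exists (T : R) (c : R -> M), strong_geodesic_loop g a T c.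

(* An orbit of the flow on TM is the image of the lift (c, c') of a magnetic
   geodesic [c]; it is periodic, with projection an embedded loop, when [c] is
   [T]-periodic and embedded modulo [T]. *)
Definition lifted_orbit (R : realType) (m : nat) (M : topologicalType)
    (A : smooth_atlas R m M) (c : R -> M) : set (M * 'rV[R]_m) :=
  range (fun t => (c t, velocity A c t)).

Definition null_homologous_embedded_orbit (R : realType) (m : nat)
    (M : topologicalType) (A : smooth_atlas R m M) (g : riemannian_metric A)
    (a : one_form A) (kappa T : R) (c : R -> M) : Prop :=
  [/\ magnetic_geodesic g a c, has_energy g kappa c,
      embedded_loop A T c & null_homologous T c].

Definition stated_properties (R : realType) (m : nat)
    (M : topologicalType) (A : smooth_atlas R m M) (n : nat)
    (T : 'I_n -> R) (gamma : 'I_n -> R -> M)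
    (g : riemannian_metric A) (a : one_form A) : Prop :=
  [/\ forall i, strong_geodesic_loop g a (T i) (gamma i),
      strong_geodesic_type g a
    & forall kappa : R, 0 < kappa ->
        exists (T' : 'I_n -> R) (delta : 'I_n -> R -> M),
        [/\ forall i, null_homologous_embedded_orbit g a kappa
                        (T' i) (delta i),
            forall i j,
              lifted_orbit A (delta i) = lifted_orbit A (delta j) -> i = j
          & kappa <= c0 g a ->
            forall i, action g a kappa (T' i) (delta i) <= 0]].

Definition agree_on (R : realType) (m : nat) (M : topologicalType)
    (A : smooth_atlas R m M) (U : set M)
    (g : riemannian_metric A) (a : one_form A)
    (g' : riemannian_metric A) (a' : one_form A) : Prop :=
  forall i x, U x -> chart_dom i x ->
    metric_coef g' i x = metric_coef g i x /\
    form_coef a' i x = form_coef a i x.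

(* Main.v *)
(* No tubular neighbourhoods are needed: [g] and [alpha] are built from global
   smooth functions. With a partition of unity, a smooth T_j-periodic function
   prescribed on each loop extends to M. So there are C_l, S_l which are
   cos(2 pi t / T_l), sin(2 pi t / T_l) on gamma_l and vanish on the other
   loops, and
     alpha = sum_l T_l / (2 pi) (2 - C_l^2 - S_l^2) (C_l dS_l - S_l dC_l)
   satisfies alpha(gamma') = 1 and dalpha(gamma', .) = 0 along every loop; the
   factor 2 - r, with r = C^2 + S^2, matters only through its first-order
   expansion at r = 1.
   Take finitely many functions h_k whose differentials span every cotangent
   space, extend the derivatives of the h_k along the loops to functions e_k,
   and put g = alpha^2 + sum_k (dh_k - e_k alpha)^2. Then g >= alpha^2, so
   |alpha|_g <= 1, and g(gamma', .) = alpha along the loops.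
   The loops are automatically geodesics: for v = gamma'(t), the function
   y |-> 2 alpha_y(v) - g_y(v, v) <= |alpha_y|_g^2 <= 1 has a maximum at
   gamma(t), and its vanishing differential, together with the derivative of
   g(gamma', .) = alpha along gamma and dalpha(gamma', .) = 0, is the geodesic
   equation. All conditions but the maximality are local, so they persist for
   (g', alpha').
   The orbit of energy kappa is gamma(s t) with s^2 = 2 kappa; its action is
   T (s - 1), while c_0 <= 1/2 because |v|^2 / 2 - alpha(v) + 1/2 >= 0. *)

Require Import Defs.
From HB Require Import structures.
From mathcomp Require Import all_boot all_order all_algebra.
From mathcomp Require Import all_classical all_reals all_analysis.
From mathcomp Require Import ring lra.

Set Implicit Arguments.
Unset Strict Implicit.
Unset Printing Implicit Defensive.

Import Order.TTheory GRing.Theory Num.Theory.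
Import numFieldNormedType.Exports.

Local Open Scope classical_set_scope.
Local Open Scope ring_scope.

(** * C^k functions *)

Section Ck.
Context (R : realType).
Implicit Types (V W : normedModType R).

(** The first-order expansion of [f] at [x] is also one for [g], so uniqueness of the differential
    identifies ['d g x] with ['d f x]. *)
Lemma near_eq_differentiable V W (f g : V -> W) (x : V) :
  (\forall y \near x, f y = g y) -> differentiable f x -> differentiable g x.
Proof.
move=> fg /diff_locallyP[dc /eqaddoP fo].
have go : g \o shift x = cst (g x) + 'd f x +o_ 0 id.
  apply/eqaddoP => e e0; rewrite -(nbhs_singleton fg).
  have := fo e e0; rewrite !near_simpl; apply: filter_app.
  have fgx : \forall y \near 0, f (y + x) = g (y + x).
    rewrite (near_shift x 0) /=; apply: filterS fg => y.
    by rewrite sub0r /= addrNK.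
  by apply: filterS fgx => y; rewrite /= !fctE /= => ->.
have dg := diff_unique dc go.
by apply/diff_locallyP; rewrite dg.
Qed.

Lemma Ck_on_sub V W k (O O' : set V) (f : V -> W) :
  O' `<=` O -> Ck_on k O f -> Ck_on k O' f.
Proof.
move=> OO'; elim: k f => [f Cf x /OO' /Cf//|k IH f [df Df]].
by split=> [x /OO' /df//|v]; exact/IH/Df.
Qed.

(** Derivatives are taken in the ambient space and never relative to [O], so the condition can be
    tested one point at a time. The chart may then depend on the point. *)
Lemma Ck_on_pt V W k (O : set V) (f : V -> W) :
  (forall x, O x -> Ck_on k [set x] f) -> Ck_on k O f.
Proof.
elim: k f => [f Cf x Ox|k IH f Cf]; first exact: (Cf x Ox).
split=> [x /Cf [df _]|v]; first exact: df.
by apply: IH => x /Cf [_ Df]; exact: Df.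
Qed.

Lemma Ck_on_near V W k (O : set V) (f g : V -> W) :
  (forall x, O x -> \forall y \near x, f y = g y) ->
  Ck_on k O f -> Ck_on k O g.
Proof.
elim: k f g => [f g fg Cf x Ox|k IH f g fg [df Df]].
  have fgx := fg x Ox.
  rewrite /prop_for /continuous_at -(nbhs_singleton fgx).
  exact: cvg_trans (near_eq_cvg fgx) (Cf x Ox).
split=> [x Ox|v]; first exact: near_eq_differentiable (fg x Ox) (df x Ox).
apply: (IH ('D_v f)); last exact: Df.
move=> x Ox.
(* Equality near [x] is equality near every point close to [x], so the derivatives agree near [x] as
   well. *)
have /near_join := fg x Ox; apply: filterS => y; exact: near_eq_derive.
Qed.

Lemma Ck_on_eq V W k (O : set V) (f g : V -> W) :
  open O -> (forall x, O x -> f x = g x) -> Ck_on k O f -> Ck_on k O g.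
Proof.
move=> oO fg; apply: Ck_on_near => x Ox.
by apply: filterS (fg) _; exact: open_nbhs_nbhs.
Qed.

Lemma Ck_onW V W k (O : set V) (f : V -> W) : Ck_on k.+1 O f -> Ck_on k O f.
Proof.
elim: k f => [f [df _] x Ox|k IH f [df Df]].
  exact/differentiable_continuous/df.
by split=> // v; exact/IH/Df.
Qed.

Lemma Ck_on_cst V W k (O : set V) (a : W) : Ck_on k O (fun=> a).
Proof.
elim: k a => [a x _|k IH a]; first exact: cst_continuous.
split=> // v; have -> : 'D_v (fun _ : V => a) = (fun=> 0 : W); last exact: IH.
by apply/funext => x; rewrite (derive_cst a).
Qed.

Lemma Ck_on_add V W k (O : set V) (f g : V -> W) : open O ->
  Ck_on k O f -> Ck_on k O g -> Ck_on k O (fun x => f x + g x).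
Proof.
move=> oO; elim: k f g => [f g Cf Cg x Ox|k IH f g [df Df] [dg Dg]].
  by apply: cvgD; [exact: Cf|exact: Cg].
split=> [x Ox|v]; first exact: (differentiableD (df x Ox) (dg x Ox)).
apply: (@Ck_on_eq _ _ _ _ (fun x => 'D_v f x + 'D_v g x)) => //;
  last by apply: IH; [exact: Df|exact: Dg].
by move=> x Ox; rewrite -deriveD //; apply: diff_derivable; [exact: df|exact: dg].
Qed.

Lemma Ck_on_mul V k (O : set V) (f g : V -> R^o) : open O ->
  Ck_on k O f -> Ck_on k O g -> @Ck_on R V R^o k O (fun x => f x * g x).
Proof.
move=> oO; elim: k f g => [f g Cf Cg x Ox|k IH f g Cf Cg].
  by apply: continuousM; [exact: Cf|exact: Cg].
have [[df Df] [dg Dg]] := (Cf, Cg).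
split=> [x Ox|v]; first exact: (differentiableM (df x Ox) (dg x Ox)).
apply: (@Ck_on_eq _ R^o _ _ (fun x => f x * 'D_v g x + g x * 'D_v f x)) => //.
  move=> x Ox; rewrite -[RHS]/('D_v ((f : V -> R) * g) x) deriveM //.
    exact/diff_derivable/df.
  exact/diff_derivable/dg.
by apply: Ck_on_add => //; apply: IH;
  do [exact: Ck_onW|exact: Df|exact: Dg].
Qed.

Lemma Ck_on_sum V W k (O : set V) (I : Type) (r : seq I) (P : pred I)
    (f : I -> V -> W) : open O ->
  (forall i, P i -> Ck_on k O (f i)) ->
  Ck_on k O (fun x => \sum_(i <- r | P i) f i x).
Proof.
move=> oO Cf; elim: r => [|i r IH].
  have -> : (fun x => \sum_(i <- [::] | P i) f i x) = (fun=> 0 : W).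
    by apply/funext => x; rewrite big_nil.
  exact: Ck_on_cst.
have -> : (fun x => \sum_(j <- i :: r | P j) f j x) =
    (fun x => (if P i then f i x else 0) + \sum_(j <- r | P j) f j x).
  by apply/funext => x; rewrite big_cons; case: ifP => // _; rewrite add0r.
apply: Ck_on_add => //; move: (Cf i).
by case: (P i) => Ci; [exact: Ci|exact: Ck_on_cst].
Qed.

Lemma Ck_on_inv V k (O : set V) (f : V -> R^o) : open O ->
  (forall x, O x -> f x != 0) ->
  Ck_on k O f -> @Ck_on R V R^o k O (fun x => (f x)^-1).
Proof.
move=> oO f0; elim: k f f0 => [f f0 Cf x Ox|k IH f f0 Cf].
  by apply: cvgV; [exact: f0|exact: Cf].
have [df Df] := Cf.
split=> [x Ox|v]; first exact: (differentiableV (df x Ox) (f0 x Ox)).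
apply: (@Ck_on_eq _ R^o _ _ (fun x => -1 * ((f x)^-1 * (f x)^-1 * 'D_v f x))) => //.
  move=> x Ox; have -> := @deriveV R V f x v (f0 x Ox) (diff_derivable (df x Ox)).
  by rewrite mulN1r expr2 invfM -mulNr.
have Ci : @Ck_on R V R^o k O (fun x => (f x)^-1) by apply: IH => //; exact: Ck_onW.
apply: Ck_on_mul => //; first exact: Ck_on_cst.
by apply: Ck_on_mul; [|exact: Ck_on_mul|exact: Df].
Qed.

Lemma differentiable_entry V m n (f : V -> 'M[R]_(m, n)) i j x :
  differentiable f x -> @differentiable_def R V R^o (fun y => f y i j) _ (Phantom _ (nbhs x)).
Proof.
move=> df; exact: (@differentiable_comp _ _ _ R^o f _ x df (differentiable_coord _ i j)).
Qed.

Lemma derive_entry V m n (f : V -> 'M[R]_(m, n)) i j v x :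
  differentiable f x -> 'D_v (fun y => f y i j : R^o) x = 'D_v f x i j.
Proof. by move=> df; rewrite derive_mx ?mxE //; exact: diff_derivable. Qed.

Lemma Ck_on_entry V m n k (O : set V) (f : V -> 'M[R]_(m, n)) i j : open O ->
  Ck_on k O f -> @Ck_on R V R^o k O (fun x => f x i j).
Proof.
move=> oO; elim: k f => [f Cf x Ox|k IH f [df Df]].
  exact: (continuous_comp (Cf x Ox) (@coord_continuous _ _ _ i j _)).
split=> [x Ox|v]; first exact: differentiable_entry (df x Ox).
apply: (@Ck_on_eq _ R^o _ _ (fun x => 'D_v f x i j)) => //;
  last by apply: IH; exact: Df.
by move=> x Ox; rewrite derive_entry //; exact: df.
Qed.

Lemma derive_chain_row V m (f : V -> 'rV[R]_m) (g : 'rV[R]_m -> R^o) v x :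
  differentiable f x -> differentiable g (f x) ->
  'D_v (g \o f) x =
  \sum_a 'D_(delta_mx ord0 a) g (f x) * 'D_v (fun y => f y ord0 a : R^o) x.
Proof.
move=> df dg; rewrite deriveE; last exact: differentiable_comp.
rewrite diff_comp //= -(deriveE _ df) {1}['D_v f x]row_sum_delta linear_sum.
by apply: eq_bigr => a _; rewrite linearZ /= derive_entry // -deriveE // mulrC.
Qed.

(** By the chain rule the derivative is a sum of products of ['D_(delta_mx ord0 a) g \o f] with
    derivatives of the coordinates of [f]; the induction on [k] runs over all [g] with [f] fixed. *)
Lemma Ck_on_comp_row V m k (O : set V) (P : set 'rV[R]_m) (f : V -> 'rV[R]_m)
    (g : 'rV[R]_m -> R^o) : open O ->
  (forall x, O x -> P (f x)) ->
  Ck_on k O f -> Ck_on k P g -> Ck_on k O (g \o f).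
Proof.
move=> oO fP; elim: k g => [g Cf Cg x Ox|k IH g Cf Cg].
  by apply: continuous_comp; [exact: Cf|exact/Cg/fP].
have [[df Df] [dg Dg]] := (Cf, Cg).
split=> [x Ox|v].
  by apply: differentiable_comp; [exact: df|exact/dg/fP].
apply: (@Ck_on_eq _ R^o _ _ (fun x => \sum_a
  (('D_(delta_mx ord0 a) g \o f) x * 'D_v (fun y => f y ord0 a : R^o) x))) => //.
  by move=> x Ox; rewrite derive_chain_row //; [exact: df|exact/dg/fP].
apply: Ck_on_sum => // a _; apply: Ck_on_mul => //.
  by apply: IH; [exact: Ck_onW|exact: Dg].
by have [_ ] := @Ck_on_entry _ _ _ _ _ _ ord0 a oO Cf; exact.
Qed.

Lemma derive_chain1 V (f : V -> R^o) (g : R^o -> R^o) v x :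
  differentiable f x -> differentiable g (f x) ->
  'D_v (g \o f) x = 'D_1 g (f x) * 'D_v f x.
Proof.
move=> df dg; rewrite deriveE; last exact: differentiable_comp.
rewrite diff_comp //= -(deriveE _ df) -[X in 'd g _ X]mulr1 -[_ * 1]/(_ *: (1 : R^o)).
by rewrite linearZ /= -deriveE // mulrC.
Qed.

Lemma Ck_on_comp1 V k (O : set V) (P : set R^o) (f : V -> R^o)
    (g : R^o -> R^o) : open O ->
  (forall x, O x -> P (f x)) ->
  Ck_on k O f -> Ck_on k P g -> Ck_on k O (g \o f).
Proof.
move=> oO fP; elim: k g => [g Cf Cg x Ox|k IH g Cf Cg].
  by apply: continuous_comp; [exact: Cf|exact/Cg/fP].
have [[df Df] [dg Dg]] := (Cf, Cg).
split=> [x Ox|v].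
  by apply: differentiable_comp; [exact: df|exact/dg/fP].
apply: (@Ck_on_eq _ R^o _ _ (fun x => ('D_1 g \o f) x * 'D_v f x)) => //.
  by move=> x Ox; rewrite derive_chain1 //; [exact: df|exact/dg/fP].
apply: Ck_on_mul => //; last exact: Df.
by apply: IH; [exact: Ck_onW|exact: Dg].
Qed.

Lemma Ck_on_coord k m n (O : set 'M[R]_(m, n)) i j :
  @Ck_on R _ R^o k O (fun x => x i j).
Proof.
case: k => [x _|k]; first exact: coord_continuous.
split=> [x _|v]; first exact: differentiable_coord.
have -> : 'D_v (fun x : 'M[R]_(m, n) => x i j : R^o) = (fun=> v i j);
  last exact: Ck_on_cst.
by apply/funext => x; rewrite (@derive_entry _ _ _ id) // derive_id.
Qed.

End Ck.

(** * Bump functions *)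

Section Bump.
Context (R : realType).

(* The family [p(1/t) exp(-1/t)], with [p] a polynomial, is stable under
   differentiation. *)
Definition flat (p : {poly R}) (t : R) : R :=
  if 0 < t then p.[t^-1] * expR (- t^-1) else 0.

(** With [u = 1/t] one has [du/dt = - u^2], so the derivative of [p(u) exp(-u)] is
    [u^2 (p - p')(u) exp(-u)]. *)
Definition flat_deriv (p : {poly R}) : {poly R} := 'X^2 * (p - p^`()).

Lemma exprn_le_expR (x : R) n : 0 <= x -> x ^+ n <= n`!%:R * expR x.
Proof.
move=> x0; have n0 : 0 < n`!%:R :> R by rewrite ltr0n fact_gt0.
rewrite mulrC -ler_pdivrMr //; case: n {n0} => [|n].
  by rewrite expr0 fact0 divr1 (le_trans _ (expR_ge1Dx x)) // lerDl.
by apply: le_trans (expR_ge1Dxn n x0); rewrite lerDr.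
Qed.

Lemma horner_le_expR (p : {poly R}) :
  exists2 C, 0 <= C & forall x, 0 <= x -> `|p.[x]| <= C * expR x.
Proof.
exists (\sum_(i < size p) `|p`_i| * i`!%:R).
  by apply: sumr_ge0 => i _; rewrite mulr_ge0.
move=> x x0; rewrite horner_coef mulr_suml.
apply: le_trans (ler_norm_sum _ _ _) _; apply: ler_sum => i _.
rewrite normrM -mulrA ler_wpM2l // ger0_norm ?exprn_ge0 //.
exact: exprn_le_expR.
Qed.

(** The exponential dominates ['X^2 * p] at [1/t], which leaves a factor [t ^+ 2]. This quadratic
    bound makes the derivative at the origin vanish. *)
Lemma flat_le_sqr (p : {poly R}) :
  exists2 C, 0 <= C & forall t, `|flat p t| <= C * t ^+ 2.
Proof.
have [C C0 pC] := horner_le_expR ('X^2 * p).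
exists C => // t; rewrite /flat; case: ifPn => [t0|_]; last first.
  by rewrite normr0 mulr_ge0 // sqr_ge0.
have ti0 : 0 < t^-1 by rewrite invr_gt0.
have := pC _ (ltW ti0); rewrite hornerM hornerXn normrM => le_p; rewrite normrM.
rewrite [X in _ * X]ger0_norm ?expR_ge0 // expRN ler_pdivrMr ?expR_gt0 //.
move: le_p; rewrite (ger0_norm (ltW (exprn_gt0 2 ti0))) -ler_pdivlMl ?exprn_gt0 //.
by rewrite exprVn invrK mulrA [C * _]mulrC.
Qed.

Lemma is_derive_flat (p : {poly R}) (t : R) :
  is_derive t 1 (flat p) (flat (flat_deriv p) t).
Proof.
have [t0|t0|->] := ltrgtP t 0.
- apply: (@near_eq_is_derive R R R (cst 0)).
    near=> s; rewrite /flat ifN // -leNgt ltW //.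
    by near: s; exact: lt_nbhsl.
  by rewrite /flat ifN -?leNgt ?ltW //; exact: is_derive_cst.
- apply: (@near_eq_is_derive R R R (fun s : R => p.[s^-1] * expR (- s^-1))).
    near=> s; rewrite /flat ifT //.
    by near: s; exact: lt_nbhsr.
  have tn0 : t != 0 by rewrite gt_eqF.
  have dV : is_derive t 1 (fun s : R => s^-1) (- t ^- 2).
    by apply: is_derive_eq (is_deriveV tn0 (is_derive_id t 1)) _; rewrite [LHS]mulr1.
  have dp : is_derive t 1 (horner p \o GRing.inv) (p^`().[t^-1] * - t ^- 2).
    by apply: is_derive1_comp; exact: is_derive_poly.
  have dN : is_derive t 1 (fun s : R => - s^-1) (- - t ^- 2) by exact: is_deriveN.
  have de : is_derive t 1 (expR \o (fun s => - s^-1)) (expR (- t^-1) * - - t ^- 2).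
    by apply: is_derive1_comp; exact: is_derive_expR.
  apply: is_derive_eq (is_deriveM dp de) _.
  rewrite /flat t0 /flat_deriv hornerM hornerXn hornerD hornerN /= -![_ *: _]/(_ * _).
  by rewrite exprVn; ring.
(* At the origin the slope function [flat p z / z] is bounded by [C |z|], and since [0^-1 = 0] its
   value at 0 is the required derivative 0. *)
- apply/is_derive1_caratheodory.
  have [C C0 pC] := flat_le_sqr p.
  exists (fun z => flat p z / z); split.
  + move=> z; rewrite [flat p 0]/flat ltxx !subr0.
    have [->|z0] := eqVneq z 0; first by rewrite mulr0 /flat ltxx.
    by rewrite divfK.
  + rewrite /prop_for /continuous_at; have -> : flat p 0 / 0 = 0 by rewrite invr0 mulr0.
    have C1 : 0 < C + 1 by rewrite ltr_wpDl.
    apply/cvgr0Pnorm_le => e e0.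
    have ltC : \forall z \near (0 : R), `|z| < e / (C + 1).
      by apply: pseudometric_normed_Zmodule.nbhs0_lt; rewrite divr_gt0.
    near=> z; have [->|z0] := eqVneq z 0; first by rewrite invr0 mulr0 normr0 ltW.
    rewrite normrM normfV ler_pdivrMr ?normr_gt0 //.
    apply: le_trans (pC z) _; rewrite -real_normK ?num_real // expr2 mulrA.
    rewrite ler_wpM2r // (@le_trans _ _ ((C + 1) * `|z|)) //.
      by rewrite ler_wpM2r // lerDl.
    rewrite mulrC -ler_pdivlMr // ltW //; near: z.
    exact: ltC.
  + by rewrite invr0 mulr0 /flat ltxx.
Unshelve. all: by end_near. Qed.

Lemma smooth_flat (p : {poly R}) : @smooth_on R R^o R^o setT (flat p).
Proof.
move=> k; elim: k p => [p x _|k IH p].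
  apply: differentiable_continuous; apply/derivable1_diffP.
  by have [] := is_derive_flat p x.
have dp x : differentiable (flat p : R^o -> R^o) x.
  by apply/derivable1_diffP; have [] := is_derive_flat p x.
split=> [x _|v]; first exact: dp.
have -> : 'D_v (flat p : R^o -> R^o) = (fun x => v * flat (flat_deriv p) x).
  apply/funext => x; rewrite deriveE // -[v in LHS]mulr1 -[_ * 1]/(v *: (1 : R^o)).
  rewrite linearZ /= -deriveE //.
  by have [_ ->] := is_derive_flat p x.
by apply: Ck_on_mul; [exact: openT|exact: Ck_on_cst|exact: IH].
Qed.

(** The bump is [exp(-1/S)] where [S = r^2 - |y - c|^2] is positive, that is, on a Euclidean ball;
    its points have all coordinates within [r] of those of [c]. *)
Lemma exists_bump m (c : 'rV[R]_m) (r : R) : 0 < r ->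
  exists B : 'rV[R]_m -> R^o,
  [/\ smooth_on setT B, forall y, 0 <= B y, 0 < B c
    & forall y, B y != 0 -> forall a, `|y ord0 a - c ord0 a| < r].
Proof.
move=> r0; pose S (y : 'rV[R]_m) : R^o :=
  r ^+ 2 + \sum_a -1 * ((y ord0 a - c ord0 a) * (y ord0 a - c ord0 a)).
have SE y : S y = r ^+ 2 - \sum_a (y ord0 a - c ord0 a) ^+ 2.
  by rewrite /S -sumrN; congr (_ + _); apply: eq_bigr => a _; rewrite mulN1r.
exists (flat 1%:P \o S); split => [k|y||y /=].
- apply: (@Ck_on_comp1 _ _ _ _ setT) => //; first exact: openT.
    apply: Ck_on_add; [exact: openT|exact: Ck_on_cst|].
    apply: Ck_on_sum => [|a _]; first exact: openT.
    have C1 : @Ck_on R _ R^o k setT (fun y : 'rV[R]_m => y ord0 a - c ord0 a).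
      by apply: Ck_on_add; [exact: openT|exact: Ck_on_coord|exact: Ck_on_cst].
    apply: Ck_on_mul; [exact: openT|exact: Ck_on_cst|].
    by apply: Ck_on_mul => //; exact: openT.
  exact: smooth_flat.
- rewrite /= /flat; case: ifP => // _.
  by rewrite hornerC mul1r expR_ge0.
- rewrite /= SE big1 => [|a _]; last by rewrite subrr expr0n.
  by rewrite subr0 /flat exprn_gt0 // hornerC mul1r expR_gt0.
rewrite /flat; case: ifP => [|_]; last by rewrite eqxx.
rewrite SE subr_gt0 => lt_r _ a.
rewrite -(@ltr_pXn2r _ 2) ?nnegrE ?(ltW r0) // real_normK ?num_real //.
apply: le_lt_trans lt_r; rewrite (bigD1 a) //= lerDl.
by apply: sumr_ge0 => b _; exact: sqr_ge0.
Qed.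

Lemma compact_cube m (c : 'rV[R]_m) (r : R) :
  compact [set y : 'rV[R]_m | forall a, `|y ord0 a - c ord0 a| <= r].
Proof.
have := @rV_compact R m (fun a => [set t | `|t - c ord0 a| <= r]); apply => a.
rewrite (_ : mkset _ = `[c ord0 a - r, c ord0 a + r]%classic).
  exact: segment_compact.
by apply/funext => t /=; rewrite in_itv /= ler_distl.
Qed.

End Bump.

(** * Inverse functions in one variable *)

Section LocalInverse.
Context (R : realType).

Lemma derive_scal1 (f : R^o -> R^o) (x v : R^o) :
  differentiable f x -> 'D_v f x = v * 'D_1 f x.
Proof.
move=> df; rewrite !deriveE // -[v in LHS]mulr1 -[_ * 1]/(v *: (1 : R^o)).
by rewrite linearZ.
Qed.

Lemma Ck_onS1 k (O : set R^o) (f : R^o -> R^o) : open O ->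
  (forall x, O x -> differentiable f x) -> Ck_on k O ('D_1 f) ->
  Ck_on k.+1 O f.
Proof.
move=> oO df Df; split=> // v.
apply: (@Ck_on_eq _ _ R^o _ _ (fun x => v * 'D_1 f x)) => //.
  by move=> x Ox; rewrite (derive_scal1 v (df x Ox)).
by apply: Ck_on_mul => //; exact: Ck_on_cst.
Qed.

(** The derivative does not vanish near [t0], so by Rolle [c] is injective on an interval [I] around
    [t0]; [tau] inverts [c] on the image of [I]. *)
Lemma local_inverse (c : R^o -> R^o) (O : set R^o) (t0 : R) :
  open O -> O t0 -> smooth_on O c -> 'D_1 c t0 != 0 ->
  exists e (J : set R^o) (tau : R^o -> R^o),
  [/\ 0 < e, open J, smooth_on J tau &
      forall t, `|t - t0| < e -> [/\ O t, J (c t) & tau (c t) = t]].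
Proof.
move=> oO Ot0 Sc c't0.
have dc x : O x -> differentiable c x by move=> Ox; have [dc _] := Sc 1; exact: dc.
have Sc' : smooth_on O ('D_1 c) by move=> k; have [_] := Sc k.+1; exact.
have c'c x : O x -> {for x, continuous ('D_1 c)} by move=> Ox; exact: (Sc' 0).
have : \forall t \near t0, O t /\ 'D_1 c t != 0.
  apply: filterI; first exact: open_nbhs_nbhs.
  have := @cvgr_neq0 R R^o R^o _ _ ('D_1 c) ('D_1 c t0) (c'c _ Ot0) c't0.
  exact.
move=> /nbhs_ballP [e /= e0 He].
pose I : set R^o := [set t | `|t - t0| < e].
have IO t : I t -> O t /\ 'D_1 c t != 0.
  by move=> It; apply: He; rewrite -ball_normE /= distrC.
have inj s t : I s -> I t -> c s = c t -> s = t.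
  move=> Is It; wlog : s t Is It / s < t.
    move=> H cst; have [st|ts|//] := ltgtP s t; first exact: H.
    by apply/esym/H.
  move=> st cst; exfalso.
  have Ist x : x \in `[s, t] -> I x.
    rewrite in_itv /= => /andP[sx xt]; move: Is It; rewrite /I /= !ltr_norml.
    by move=> /andP[? ?] /andP[? ?]; apply/andP; split; lra.
  have [x xst Dx] : exists2 x, x \in `]s, t[%R & is_derive x 1 (c : R -> R) 0.
    apply: Rolle => //.
      move=> x xst; apply/derivable1_diffP/dc.
      by apply: (IO _ _).1; apply: Ist; exact: subset_itv_oo_cc.
    apply: derivable_within_continuous => x xst.
    by apply/derivable1_diffP/dc; exact: (IO _ (Ist _ xst)).1.
  have [_] := IO x (Ist _ (subset_itv_oo_cc xst)).
  by case: Dx => _ ->; rewrite eqxx.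
pose tau (y : R^o) : R^o := get [set t : R^o | I t /\ c t = y].
have cK t : I t -> tau (c t) = t.
  move=> It; have [] : [set s : R^o | I s /\ c s = c t] (tau (c t)).
    by apply: getPex; exists t.
  by move=> Is; exact: inj.
have oI : open I.
  have -> : I = ball (t0 : R^o) e.
    by apply/funext => t; rewrite -ball_normE /I /= distrC.
  by apply: ball_open.
have nI t : I t -> \forall s \near t, I s by move=> It; exact: open_nbhs_nbhs.
have nK t : I t -> {near t, cancel c tau} by move=> It; apply: filterS (nI t It) => s; exact: cK.
have nC t : I t -> {near t, continuous c}.
  move=> It; apply: filterS (nI t It) => s /IO[Os _].
  exact/differentiable_continuous/dc.
have dtau t : I t -> is_derive (c t) 1 tau ('D_1 c t)^-1.
  move=> It; have [Ot c't] := IO t It.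
  apply: (@is_derive_inverse R c tau ('D_1 c t) t) => //; [exact: nK|exact: nC|].
  by split=> //; exact/diff_derivable/dc.
pose J : set R^o := c @` I.
(* Near [c t], [tau] is a right inverse of [c], and it is continuous at [c t]; so every [y] close to
   [c t] is the image of the point [tau y] of [I]. *)
have oJ : open J.
  rewrite openE => _ [t It <-].
  have [nCt nKt] := near_can_continuousAcan_sym (nK t It) (nC t It).
  have := nbhs_singleton nCt; rewrite /= /continuous_at cK // => /(_ _ (nI t It)).
  rewrite /nbhs /= => nIt; near=> y; exists (tau y); last by near: y.
  by near: y.
exists e, J, tau; split=> //; last first.
  by move=> t It; split; [exact: (IO t It).1|exists t|exact: cK].
have dt y : J y -> differentiable tau y.
  by move=> [t It <-]; apply/derivable1_diffP; have [] := dtau t It.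
(* Bootstrapping: [tau' = 1 / (c' \o tau)] has the class of [tau], so each step gains one order. *)
elim=> [y Jy|k IH]; first exact/differentiable_continuous/dt.
apply: Ck_onS1 => //.
apply: (@Ck_on_eq _ _ R^o _ _ (fun y => (('D_1 c \o tau) y)^-1)) => //.
  by move=> _ [t It <-] /=; rewrite cK //; have [_ ->] := dtau t It.
apply: Ck_on_inv => //.
  by move=> _ [t It <-] /=; rewrite cK //; exact: (IO t It).2.
by apply: (@Ck_on_comp1 _ _ _ _ O) => // _ [t It <-]; rewrite cK //; exact: (IO t It).1.
Unshelve. all: by end_near. Qed.

End LocalInverse.

(** * Smooth functions on a manifold *)

Section SmoothFunctions.
Context (R : realType) (m : nat) (M : topologicalType) (A : smooth_atlas R m M).
Implicit Types (i j : chart_index A) (F G : M -> R).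

Definition smooth_fun F : Prop := forall i, smooth_in_chart i F.

Lemma chart_preimage_open i (O : set 'rV[R]_m) :
  open O -> open [set x | chart_dom i x /\ O (chart i x)].
Proof.
move=> oO; rewrite openE => x [ix Ox]; rewrite /interior.
apply: filterI; first exact: open_nbhs_nbhs (conj (chart_dom_open i) ix).
exact: (chart_continuous ix (open_nbhs_nbhs (conj oO Ox))).
Qed.

Lemma chart_image_open i (W : set M) :
  open W -> open (chart i @` (chart_dom i `&` W)).
Proof.
move=> oW; rewrite openE => _ [x [ix Wx] <-]; rewrite /interior.
have nimg : nbhs (chart i x) (chart i @` chart_dom i).
  by apply: open_nbhs_nbhs; split; [exact: chart_img_open|exists x].
have ninv : nbhs (chart i x) [set y | W (chart_inv i y)].
  apply: (chart_inv_continuous ix); rewrite chartK //.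
  exact: open_nbhs_nbhs.
apply: filterS (filterI nimg ninv) => _ [[z iz <-] /=].
by rewrite chartK // => Wz; exists z.
Qed.

Lemma transition_Ck i j k : Ck_on k
  (chart i @` (chart_dom i `&` chart_dom j)) (chart j \o chart_inv i).
Proof. exact: transition_smooth. Qed.

(** One chart around each point suffices, because any other chart differs from it by a smooth
    transition map. *)
Lemma smooth_fun_local F :
  (forall x, exists i (O : set 'rV[R]_m), [/\ chart_dom i x, open O, O (chart i x) &
      @smooth_on R _ R^o O (F \o chart_inv i)]) -> smooth_fun F.
Proof.
move=> Floc j k; apply: Ck_on_pt => _ [x jx <-].
have [i [Q [ix oQ Qx SF]]] := Floc x.
pose W := [set z | chart_dom i z /\ Q (chart i z)].
pose P := chart j @` (chart_dom j `&` W).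
have oP : open P by apply: chart_image_open; exact: chart_preimage_open.
apply: (@Ck_on_sub _ _ _ _ P) => [_ ->|]; first by exists x.
apply: (@Ck_on_eq _ _ _ _ _ ((F \o chart_inv i) \o (chart i \o chart_inv j))) => //.
  by move=> _ [z [jz [iz Qz]] <-] /=; rewrite (chartK jz) (chartK iz).
apply: (Ck_on_comp_row oP _ _ (SF k)).
  by move=> _ [z [jz [iz Qz]] <-] /=; rewrite (chartK jz).
apply: Ck_on_sub (@transition_Ck j i k) => _ [z [jz [iz Qz]] <-].
by exists z.
Qed.

Lemma smooth_fun_cst (a : R) : smooth_fun (fun=> a).
Proof. by move=> i k; exact: Ck_on_cst. Qed.

Lemma smooth_in_chartD i F G : smooth_in_chart i F -> smooth_in_chart i G ->
  smooth_in_chart i (fun x => F x + G x).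
Proof.
by move=> SF SG k; apply: Ck_on_add; [exact: chart_img_open|exact: SF|exact: SG].
Qed.

Lemma smooth_in_chartM i F G : smooth_in_chart i F -> smooth_in_chart i G ->
  smooth_in_chart i (fun x => F x * G x).
Proof.
by move=> SF SG k; apply: Ck_on_mul; [exact: chart_img_open|exact: SF|exact: SG].
Qed.

Lemma smooth_in_chart_sum i (I : Type) (r : seq I) (F : I -> M -> R) :
  (forall n, smooth_in_chart i (F n)) ->
  smooth_in_chart i (fun x => \sum_(n <- r) F n x).
Proof.
by move=> SF k; apply: Ck_on_sum; [exact: chart_img_open|move=> n _; exact: SF].
Qed.

Lemma smooth_funD F G :
  smooth_fun F -> smooth_fun G -> smooth_fun (fun x => F x + G x).
Proof. by move=> SF SG i; exact: smooth_in_chartD. Qed.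

Lemma smooth_funM F G :
  smooth_fun F -> smooth_fun G -> smooth_fun (fun x => F x * G x).
Proof. by move=> SF SG i; exact: smooth_in_chartM. Qed.

Lemma smooth_fun_sum (I : Type) (r : seq I) (F : I -> M -> R) :
  (forall n, smooth_fun (F n)) -> smooth_fun (fun x => \sum_(n <- r) F n x).
Proof. by move=> SF i; apply: smooth_in_chart_sum => n; exact: SF. Qed.

Lemma smooth_funV F : (forall x, F x != 0) ->
  smooth_fun F -> smooth_fun (fun x => (F x)^-1).
Proof.
move=> F0 SF i k; apply: Ck_on_inv; [exact: chart_img_open| |exact: SF].
by move=> x _; exact: F0.
Qed.

(** The cube has compact image in [M], which is closed because [M] is Hausdorff. Off this image the
    function is zero on an open set; at its points the chart [i] can be used. *)
Lemma chart_extend0 i (O : set 'rV[R]_m) (c : 'rV[R]_m) (r : R)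
    (H : 'rV[R]_m -> R) : hausdorff_space M ->
  open O -> O `<=` chart i @` chart_dom i ->
  (forall y : 'rV_m, (forall a, `|y ord0 a - c ord0 a| <= r) -> O y) ->
  @smooth_on R _ R^o O H ->
  (forall y, H y != 0 -> forall a, `|y ord0 a - c ord0 a| <= r) ->
  smooth_fun (fun x => if `[< chart_dom i x >] then H (chart i x) else 0).
Proof.
move=> hM oO Oimg KO SH HK.
pose K := [set y : 'rV[R]_m | forall a, `|y ord0 a - c ord0 a| <= r].
have cK : closed (chart_inv i @` K).
  apply: compact_closed => //; apply: continuous_compact; last exact: compact_cube.
  apply: continuous_in_subspaceT => y; rewrite inE => /KO /Oimg [x ix <-].
  exact: chart_inv_continuous.
apply: smooth_fun_local => x.
have [[y Ky <-]|nKx] := pselect ((chart_inv i @` K) x).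
  have [z iz zy] := Oimg _ (KO _ Ky); exists i, O; rewrite -zy chartK //.
  split=> //; first by rewrite zy; exact: KO.
  move=> k; apply: (@Ck_on_eq _ _ _ _ _ H) => // u /Oimg [v iv <-] /=.
  by rewrite chartK // asboolT.
exists (chart_at A x), (chart (chart_at A x) @`
  (chart_dom (chart_at A x) `&` ~` (chart_inv i @` K))).
have xx := chart_at_dom A x.
have oP : open (chart (chart_at A x) @`
    (chart_dom (chart_at A x) `&` ~` (chart_inv i @` K))).
  by apply: chart_image_open; exact: closed_openC.
split=> //; first by exists x.
move=> k; apply: (@Ck_on_eq _ _ _ _ _ (fun=> 0)) => //; last exact: Ck_on_cst.
move=> _ [z [jz nKz] <-] /=; rewrite chartK //; case: asboolP => // iz.
apply/esym/eqP; apply: contra_notT nKz => /HK Kz.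
by exists (chart i z) => //; exact: chartK.
Qed.

Lemma cube_nbhs (O : set 'rV[R]_m) (c : 'rV[R]_m) : open O -> O c ->
  exists2 r, 0 < r &
    forall y : 'rV_m, (forall a, `|y ord0 a - c ord0 a| <= r) -> O y.
Proof.
move=> oO Oc; have /nbhs_ballP[e /= e0 He] := open_nbhs_nbhs (conj oO Oc).
exists (e / 2); first by rewrite divr_gt0.
move=> y yc; apply: He; split=> // a b; rewrite /ball /= (ord1 a) distrC.
by apply: le_lt_trans (yc b) _; rewrite ltr_pdivrMr // ltr_pMr // ltr1n.
Qed.

(** The last clause turns local functions into global ones: [chi] vanishes wherever [G] is not
    controlled or [chart i y] is meaningless. *)
Lemma chart_bump i x (O : set 'rV[R]_m) : hausdorff_space M ->
  chart_dom i x -> open O -> O (chart i x) ->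
  exists chi : M -> R,
  [/\ smooth_fun chi, forall y, 0 <= chi y, 0 < chi x,
      forall y, chi y != 0 -> chart_dom i y /\ O (chart i y)
    & forall G : 'rV[R]_m -> R,
        @smooth_on R _ R^o (O `&` chart i @` chart_dom i) G ->
        smooth_fun (fun y => chi y * G (chart i y))].
Proof.
move=> hM ix oO Ox; pose O' := O `&` chart i @` chart_dom i.
have oO' : open O' by apply: openI => //; exact: chart_img_open.
have O'x : O' (chart i x) by split=> //; exists x.
have [r r0 KO] := cube_nbhs oO' O'x.
have [B [SB B0 Bx BK]] := exists_bump (chart i x) r0.
have BK' y : B y != 0 -> forall a, `|y ord0 a - chart i x ord0 a| <= r.
  by move=> /BK By a; exact/ltW/By.
have O'img : O' `<=` chart i @` chart_dom i by move=> y [].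
exists (fun y => if `[< chart_dom i y >] then B (chart i y) else 0); split.
- apply: (@chart_extend0 _ O' (chart i x) r) => // k.
  exact: Ck_on_sub (SB k).
- by move=> y; case: ifP.
- by rewrite asboolT.
- move=> y; case: asboolP; last by rewrite eqxx.
  by move=> iy /BK' /KO [].
move=> G SG; pose H z := B z * G z.
have -> : (fun y => (if `[< chart_dom i y >] then B (chart i y) else 0) *
    G (chart i y)) = (fun y => if `[< chart_dom i y >] then
    H (chart i y) else 0).
  by apply/funext => y; case: ifP => //; rewrite mul0r.
apply: (@chart_extend0 i O' (chart i x) r H) => //.
  move=> k; apply: Ck_on_mul => //; first exact: Ck_on_sub (SB k).
by move=> y; rewrite /H mulf_eq0 negb_or => /andP[/BK' By _].
Qed.

End SmoothFunctions.

(** * Symmetry of second derivatives *)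

Section Schwarz.
Context (R : realType) (V : normedModType R).

Lemma is_derive_line (W : normedModType R) (f : V -> W) (p u : V) (s : R) :
  differentiable f (s *: u + p) ->
  is_derive s 1 (fun s : R => f (s *: u + p)) ('D_u f (s *: u + p)).
Proof.
move=> df.
have E : (fun h : R => h^-1 *: (((fun s : R => f (s *: u + p)) \o shift s)
      (h *: (1 : R)) - f (s *: u + p))) =
    (fun h => h^-1 *: ((f \o shift (s *: u + p)) (h *: u) - f (s *: u + p))).
  apply/funext => h /=; rewrite addrA -scalerDl.
  by have -> : h *: (1 : R) = h by exact: mulr1.
split; last by rewrite /derive E.
have := diff_derivable (v := u) df; by rewrite /derivable E.
Qed.

(** The mean value theorem is applied twice, first in the direction [u] to a difference in the
    direction [v], then in the direction [v] to ['D_u f]. *)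
Lemma second_difference (O : set V) (f : V -> R^o) (x u v : V) (h : R) :
  Ck_on 2 O f -> 0 < h ->
  (forall s t, 0 <= s <= h -> 0 <= t <= h -> O (s *: u + (t *: v + x))) ->
  exists s t, [/\ 0 <= s <= h, 0 <= t <= h &
    f (h *: u + (h *: v + x)) - f (h *: u + x) - (f (h *: v + x) - f x) =
      'D_v ('D_u f) (s *: u + (t *: v + x)) * h * h].
Proof.
move=> [df Df] h0 sub.
have [dDf _] := Df u.
have h0h : 0 <= h <= h by rewrite (ltW h0) /=.
have h00 : (0 : R) <= 0 <= h by rewrite lexx (ltW h0).
have [||s] := @MVT R (fun s => f (s *: u + (h *: v + x)) - f (s *: u + x))
  (fun s => 'D_u f (s *: u + (h *: v + x)) - 'D_u f (s *: u + x)) 0 h h0.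
- move=> s; rewrite in_itv /= => /andP[s0 sh].
  have s0h : 0 <= s <= h by rewrite !ltW.
  apply: is_deriveB; apply: (@is_derive_line R^o f); apply: df; first exact: sub.
  by have := sub s 0 s0h h00; rewrite scale0r add0r.
- apply: derivable_within_continuous => s; rewrite in_itv /= => s0h.
  apply: derivableB.
    by apply: ex_derive; apply: (@is_derive_line R^o f); apply: df; exact: sub.
  apply: ex_derive; apply: (@is_derive_line R^o f); apply: df.
  by have := sub s 0 s0h h00; rewrite scale0r add0r.
rewrite in_itv /= !scale0r !add0r subr0 => /andP[s0 sh] ->.
have s0h : 0 <= s <= h by rewrite !ltW.
have E t : s *: u + (t *: v + x) = t *: v + (s *: u + x) by rewrite addrCA.
have [||t] := @MVT R (fun t => 'D_u f (t *: v + (s *: u + x)))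
  (fun t => 'D_v ('D_u f) (t *: v + (s *: u + x))) 0 h h0.
- move=> t; rewrite in_itv /= => /andP[t0 th].
  apply: (@is_derive_line R^o ('D_u f)); apply: dDf; rewrite -E; apply: sub => //.
  by rewrite !ltW.
- apply: derivable_within_continuous => t; rewrite in_itv /= => t0h.
  apply: ex_derive; apply: (@is_derive_line R^o ('D_u f)); apply: dDf; rewrite -E; exact: sub.
rewrite in_itv /= scale0r add0r subr0 -E => /andP[t0 th] ->.
rewrite -E; exists s, t; split; [exact: s0h|by rewrite (ltW t0) ltW|].
exact: erefl.
Qed.

(** The second difference is symmetric in [u] and [v], so the two mixed derivatives take a common
    value at points arbitrarily close to [x]. By continuity they cannot differ at [x]. *)
Lemma schwarz (O : set V) (f : V -> R^o) (x u v : V) : open O -> O x ->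
  Ck_on 2 O f -> 'D_u ('D_v f) x = 'D_v ('D_u f) x.
Proof.
move=> oO Ox Cf; apply/eqP/negPn/negP => neq.
have tri (a b c c' r : R) : `|a - c| < r -> `|b - c'| < r -> c' = c ->
    `|a - b| < r + r.
  move=> ac bc cc; rewrite -(subrKA c); apply: le_lt_trans (ler_normD _ _) _.
  by apply: ltrD => //; rewrite distrC -cc.
have cont w z : {for x, continuous ('D_w ('D_z f))}.
  by have [_ Df] := Cf; have [_ DDf] := Df z; exact: DDf.
pose e := `|'D_u ('D_v f) x - 'D_v ('D_u f) x| / 2.
have e0 : 0 < e by rewrite divr_gt0 // normr_gt0 subr_eq0.
have n1 : \forall y \near x, `|'D_u ('D_v f) x - 'D_u ('D_v f) y| < e.
  exact: cvgr_dist_lt (cont u v) _ e0.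
have n2 : \forall y \near x, `|'D_v ('D_u f) x - 'D_v ('D_u f) y| < e.
  exact: cvgr_dist_lt (cont v u) _ e0.
have nO : \forall y \near x, O y by exact: open_nbhs_nbhs.
have : nbhs x [set y | [/\ O y, `|'D_u ('D_v f) x - 'D_u ('D_v f) y| < e &
    `|'D_v ('D_u f) x - 'D_v ('D_u f) y| < e]].
  by apply: filterS3 nO n1 n2 => y.
move=> /nbhs_ballP[d /= d0 Hd].
(* The summand 1 keeps [k] positive when [u = v = 0]. The choice of [h] puts the parallelogram at
   [x] with sides [h u] and [h v] inside the ball of radius [d]. *)
pose k := `|u| + `|v| + 1; have k0 : 0 < k by rewrite ltr_wpDl ?addr_ge0.
pose h := d / k / 2.
have h0 : 0 < h by rewrite !divr_gt0.
have near_x a b s t : `|a| + `|b| < k -> 0 <= s <= h -> 0 <= t <= h ->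
    ball x d (s *: a + (t *: b + x)).
  move=> abk /andP[s0 sh] /andP[t0 th].
  rewrite -ball_normE /= addrA opprD addrCA subrr addr0 normrN.
  apply: le_lt_trans (ler_normD _ _) _; rewrite !normrZ !ger0_norm //.
  apply: (@le_lt_trans _ _ (h * (`|a| + `|b|))).
    by rewrite mulrDr lerD // ler_wpM2r.
  apply: (@le_lt_trans _ _ (h * k)); first by rewrite ler_wpM2l // ltW.
  rewrite /h mulrAC divfK ?gt_eqF //.
  by rewrite ltr_pdivrMr // ltr_pMr // ltr1n.
have uvk : `|u| + `|v| < k by rewrite ltrDl.
have vuk : `|v| + `|u| < k by rewrite addrC.
have [s [t [sh th E1]]] := second_difference (u := u) (v := v) Cf h0
  (fun s t sh th => let: And3 Oy _ _ := Hd _ (near_x u v s t uvk sh th) in Oy).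
have [s' [t' [sh' th' E2]]] := second_difference (u := v) (v := u) Cf h0
  (fun s t sh th => let: And3 Oy _ _ := Hd _ (near_x v u s t vuk sh th) in Oy).
have E : 'D_v ('D_u f) (s *: u + (t *: v + x)) =
         'D_u ('D_v f) (s' *: v + (t' *: u + x)).
  apply: (mulIf (lt0r_neq0 h0)); apply: (mulIf (lt0r_neq0 h0)).
  apply: etrans (esym E1) _; apply: etrans _ E2.
  have -> : h *: v + (h *: u + x) = h *: u + (h *: v + x) by rewrite addrCA.
  by rewrite !opprB addrACA [RHS]addrACA; congr (_ + _); exact: addrC.
have [_ _ H2] := Hd _ (near_x u v s t uvk sh th).
have [_ H1 _] := Hd _ (near_x v u s' t' vuk sh' th').
have := tri _ _ _ _ _ H1 H2 E.
by rewrite /e -splitr ltxx.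
Qed.

End Schwarz.

(** * Partial derivatives in charts *)

Section Partials.
Context (R : realType) (m : nat) (M : topologicalType) (A : smooth_atlas R m M).
Implicit Types (i j : chart_index A) (F G : M -> R) (c : R -> M).

Definition diff_row i F (x : M) : 'rV[R]_m := \row_k partial i k F x.

Lemma chart_img i x : chart_dom i x -> (chart i @` chart_dom i) (chart i x).
Proof. by move=> ix; exists x. Qed.

Lemma smooth_in_chart_diff i F x : smooth_in_chart i F -> chart_dom i x ->
  @differentiable_def R _ R^o (F \o chart_inv i) _ (Phantom _ (nbhs (chart i x))).
Proof.
by move=> SF ix; have [dF _] := SF 1; apply: dF; exact: chart_img.
Qed.

Lemma transition_diff i j x : chart_dom i x -> chart_dom j x ->
  differentiable (chart j \o chart_inv i) (chart i x).
Proof. by move=> ix jx; have [d _] := transition_Ck i j 1; apply: d; exists x. Qed.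

Lemma near_chart_inv i x (W : set M) : chart_dom i x -> nbhs x W ->
  \forall y \near chart i x, W (chart_inv i y).
Proof. by move=> ix nW; apply: (chart_inv_continuous ix); rewrite chartK. Qed.

Lemma near_chart_img i x : chart_dom i x ->
  \forall y \near chart i x, (chart i @` chart_dom i) y.
Proof.
by move=> ix; apply: open_nbhs_nbhs; split; [exact: chart_img_open|exact: chart_img].
Qed.

Lemma partial_near i k F G x : chart_dom i x ->
  (\forall y \near x, F y = G y) -> partial i k F x = partial i k G x.
Proof.
by move=> ix FG; apply: near_eq_derive; have := near_chart_inv ix FG.
Qed.

Lemma diff_row_transition i j F x : smooth_in_chart j F ->
  chart_dom i x -> chart_dom j x ->
  diff_row i F x = diff_row j F x *m (transition_jac i j x)^T.
Proof.
move=> SF ix jx; apply/rowP => k; rewrite !mxE /partial.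
have dt := transition_diff ix jx.
transitivity ('D_(delta_mx ord0 k)
    ((F \o chart_inv j) \o (chart j \o chart_inv i) : _ -> R^o) (chart i x)).
  apply: near_eq_derive.
  have jn : nbhs x (chart_dom j) by apply: open_nbhs_nbhs; split=> //; exact: chart_dom_open.
  by apply: filterS (near_chart_inv ix jn) => y jy /=; rewrite chartK.
rewrite derive_chain_row //=; last by rewrite chartK //; exact: smooth_in_chart_diff.
apply: eq_bigr => l _; rewrite !mxE chartK // derive_entry //; congr (_ * _).
by rewrite (deriveE _ dt).
Qed.

Lemma partial_chartK i k F y : (chart i @` chart_dom i) y ->
  partial i k F (chart_inv i y) =
  'D_(delta_mx ord0 k) (F \o chart_inv i : _ -> R^o) y.
Proof. by move=> [z iz <-]; rewrite /partial chartK. Qed.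

Lemma smooth_partial i k F : smooth_in_chart i F ->
  smooth_in_chart i (partial i k F).
Proof.
move=> SF n; have [_ DF] := SF n.+1.
apply: Ck_on_eq (DF (delta_mx ord0 k)); first exact: chart_img_open.
by move=> y iy /=; rewrite partial_chartK.
Qed.

Lemma partialC i k l F x : smooth_in_chart i F -> chart_dom i x ->
  partial i k (partial i l F) x = partial i l (partial i k F) x.
Proof.
move=> SF ix.
have E a b : partial i a (partial i b F) x = 'D_(delta_mx ord0 a)
    ('D_(delta_mx ord0 b) (F \o chart_inv i : _ -> R^o)) (chart i x).
  apply: near_eq_derive; apply: filterS (near_chart_img ix) => y iy /=.
  by rewrite partial_chartK.
rewrite !E; apply: (@schwarz _ _ (chart i @` chart_dom i)) => //.
exact: chart_img_open.
Qed.

Lemma partialD i k F G x : smooth_in_chart i F -> smooth_in_chart i G ->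
  chart_dom i x ->
  partial i k (fun y => F y + G y) x = partial i k F x + partial i k G x.
Proof.
move=> SF SG ix; have dF := smooth_in_chart_diff SF ix.
have dG := smooth_in_chart_diff SG ix.
by rewrite -[RHS]deriveD //; exact: diff_derivable.
Qed.

Lemma partialM i k F G x : smooth_in_chart i F -> smooth_in_chart i G ->
  chart_dom i x ->
  partial i k (fun y => F y * G y) x =
    F x * partial i k G x + G x * partial i k F x.
Proof.
move=> SF SG ix; have dF := smooth_in_chart_diff SF ix.
have dG := smooth_in_chart_diff SG ix.
have := @deriveM R _ (F \o chart_inv i) (G \o chart_inv i) _ (delta_mx ord0 k)
  (diff_derivable dF) (diff_derivable dG).
by rewrite /= chartK.
Qed.

Lemma partial_cst i k (a : R) x : partial i k (fun=> a) x = 0.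
Proof. exact: (derive_cst a). Qed.

Lemma partial_sum i k (I : Type) (r : seq I) (F : I -> M -> R) x :
  (forall n, smooth_in_chart i (F n)) -> chart_dom i x ->
  partial i k (fun y => \sum_(n <- r) F n y) x = \sum_(n <- r) partial i k (F n) x.
Proof.
move=> SF ix; elim: r => [|n r IH].
  rewrite big_nil -[RHS](partial_cst i k 0 x); congr (partial _ _ _ _).
  by apply/funext => y; rewrite big_nil.
rewrite big_cons -IH -partialD //.
  by congr (partial _ _ _ _); apply/funext => y; rewrite big_cons.
move=> p; apply: Ck_on_sum => [|q _]; [exact: chart_img_open|exact: SF].
Qed.

Lemma open_chart_time c i : continuous c -> open [set t : R^o | chart_dom i (c t)].
Proof. by move=> cc; apply: open_comp; [move=> t _; exact: cc|exact: chart_dom_open]. Qed.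

Lemma near_chart_time c i t : continuous c -> chart_dom i (c t) ->
  \forall s \near t, chart_dom i (c s).
Proof. by move=> cc it; apply: open_nbhs_nbhs; split=> //; exact: open_chart_time. Qed.

Lemma curve_diff c i t : smooth_curve A c -> chart_dom i (c t) ->
  @differentiable_def R R^o _ (chart i \o c) _ (Phantom _ (nbhs t)).
Proof. by move=> [_ Sc] it; have [dc _] := Sc i 1; exact: dc. Qed.

Lemma smooth_comp_curve F c : smooth_fun A F -> smooth_curve A c ->
  @smooth_on R R^o R^o setT (F \o c).
Proof.
move=> SF [cc Sc] k; apply: Ck_on_pt => t _.
pose i := chart_at A (c t); have it : chart_dom i (c t) := chart_at_dom A (c t).
have oT := open_chart_time (i := i) cc.
apply: (@Ck_on_sub _ _ _ _ [set t : R^o | chart_dom i (c t)]) => [_ ->//|].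
apply: (@Ck_on_eq _ _ _ _ _ ((F \o chart_inv i) \o (chart i \o c))) => //.
  by move=> s /= is_; rewrite chartK.
by apply: (Ck_on_comp_row oT _ (Sc i k) (SF i k)) => s is_ /=; exact: chart_img.
Qed.

(** This is the chain rule for functions smooth in the single chart [i], as the components of a
    tensor field are. *)
Lemma smooth_in_chart_comp_curve i F c t : smooth_in_chart i F ->
  smooth_curve A c -> chart_dom i (c t) ->
  @differentiable_def R R^o R^o (F \o c) _ (Phantom _ (nbhs t)) /\
  'D_1 (F \o c : R^o -> R^o) t =
    \sum_k partial i k F (c t) * ('D_1 (chart i \o c : R^o -> _) t) ord0 k.
Proof.
move=> SF Sc it; have [cc _] := Sc.
have nE : \forall s \near t, ((F \o chart_inv i) \o (chart i \o c)) s = (F \o c) s.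
  by apply: filterS (near_chart_time cc it) => s is_ /=; rewrite chartK.
have dF := smooth_in_chart_diff SF it.
have dc := curve_diff Sc it.
split.
  apply: near_eq_differentiable nE _.
  exact: (@differentiable_comp _ _ _ R^o (chart i \o c)).
rewrite -(@near_eq_derive R R^o R^o _ _ t 1 nE) (@derive_chain_row R R^o _ (chart i \o c)) //.
by apply: eq_bigr => k _; rewrite derive_entry.
Qed.

End Partials.

(** * Extension of functions from the loops *)

Section Extension.
Context (R : realType) (m : nat) (M : topologicalType) (A : smooth_atlas R m M).
Hypothesis hM : hausdorff_space M.
Hypothesis cM : compact [set: M].

(** Compactness selects finitely many local data whose positivity sets cover [M]. Dividing by the
    sum of the functions then does the work of a partition of unity. *)
Lemma finite_positive_family (D : Type) (P : D -> Prop) (ev : D -> M -> R) :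
  (forall d, P d -> continuous (ev d : M -> R^o)) ->
  (forall p, exists2 d, P d & 0 < ev d p) ->
  exists (d : M -> D) (s : seq M), (forall p, P (d p)) /\
    forall x, exists2 p, p \in s & 0 < ev (d p) x.
Proof.
move=> evc /(_ _)/cid2 dP; pose d p := s2val (dP p).
have dd p : P (d p) by exact: s2valP (dP p).
have evp p : 0 < ev (d p) p by exact: s2valP' (dP p).
have [[x0]|noM] := pselect (inhabited M); last first.
  by exists d, [::]; split=> // x; case: noM; exists.
(* The cover form of compactness is applied to [M] with a chosen point; the case of an empty [M] was
   settled above with the empty list. *)
pose pM : ptopologicalType := HB.pack (Topological.sort M) (isPointed.Build M x0).
have : @compact pM setT by exact: cM.
rewrite compact_cover => /(_ M setT (fun p => [set x | 0 < ev (d p) x])).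
case=> [p _|x _|s _ scov].
- have -> : [set x | 0 < ev (d p) x] = ev (d p) @^-1` [set y : R^o | 0 < y] by [].
  apply: open_comp; [by move=> x _; exact: (evc _ (dd p))|exact: open_gt].
- by exists x => //; exact: evp.
exists d, (finmap.enum_fset s); split=> // x.
by have [p ps px] := scov x I; exists p.
Qed.

Lemma smooth_fun_continuous (F : M -> R) : smooth_fun A F -> continuous (F : M -> R^o).
Proof.
move=> SF x; pose i := chart_at A x; have ix : chart_dom i x := chart_at_dom A x.
have nE : \forall y \near x, (F \o chart_inv i) (chart i y) = F y.
  have jn : nbhs x (chart_dom i) by apply: open_nbhs_nbhs; split=> //; exact: chart_dom_open.
  by apply: filterS jn => y iy /=; rewrite chartK.
apply: cvg_trans (near_eq_cvg nE) _.
rewrite -(nbhs_singleton nE).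
apply: (continuous_comp (chart_continuous ix)).
exact: (SF i 0 _ (chart_img ix)).
Qed.

Context (n : nat) (T : 'I_n -> R) (gamma : 'I_n -> R -> M).
Hypothesis gamma_emb : forall i, embedded_loop A (T i) (gamma i).
Hypothesis gamma_disj : forall i j s t, gamma i s = gamma j t -> i = j.

Lemma periodicz (U : Type) (f : R -> U) (P : R) :
  (forall t, f (t + P) = f t) -> forall (k : int) t, f (t + k%:~R * P) = f t.
Proof.
move=> fP.
have nat_case (k : nat) t : f (t + k%:R * P) = f t.
  elim: k t => [|k IH] t; first by rewrite mul0r addr0.
  by rewrite -natr1 mulrDl mul1r addrA fP IH.
case=> k t; first exact: nat_case.
rewrite NegzE mulrNz mulNr -[RHS]/(f t).
by rewrite -(nat_case k.+1 (t - k.+1%:R * P)) subrK.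
Qed.

Lemma gamma_smooth j : smooth_curve A (gamma j).
Proof. by have [[_ Sc _] _ _ _] := gamma_emb j. Qed.

(** By periodicity the image is that of one period, a compact segment, and compact sets are closed
    in a Hausdorff space. *)
Lemma loop_image_closed j : closed (range (gamma j)).
Proof.
have [[T0 [cc _] per] _ _ _] := gamma_emb j.
have -> : range (gamma j) = gamma j @` `[0, T j]%classic.
  rewrite eqEsubset; split=> _ [t _ <-]; last by exists t.
  exists (t + (- Num.floor (t / T j))%:~R * T j); last exact: periodicz.
  have /andP[le_t lt_t] := floor_itv (t / T j).
  rewrite /= in_itv /= mulrNz mulNr subr_ge0 lerBlDl.
  move: le_t lt_t; rewrite ler_pdivlMr // ltr_pdivrMr // => -> /ltW.
  by rewrite intrD mulrDl mul1r.
apply: compact_closed => //; apply: continuous_compact; last exact: segment_compact.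
by apply: continuous_subspaceT => t; exact: cc.
Qed.

(** On the loop [j] this is the homeomorphism clause of [embedded_loop]; every other loop has a
    closed image that avoids [p]. *)
Lemma near_loops p (j : 'I_n) (t0 e : R) : gamma j t0 = p -> 0 < e ->
  \forall y \near p, forall l s, gamma l s = y ->
    l = j /\ exists k : int, `|s - (t0 + k%:~R * T j)| < e.
Proof.
move=> <- e0; apply: filter_forall => l.
have [<-|lj] := eqVneq j l.
  have [_ _ _ H] := gamma_emb j.
  by apply: filterS (H t0 e e0) => y Hy s /Hy.
have : nbhs (gamma j t0) (~` range (gamma l)).
  apply: open_nbhs_nbhs; split; first by rewrite openC; exact: loop_image_closed.
  by move=> [s _ /gamma_disj ls]; move: lj; rewrite ls eqxx.
by apply: filterS => y ny s sy; exfalso; apply: ny; exists s.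
Qed.

Lemma near_no_loop p : (forall l s, gamma l s <> p) ->
  \forall y \near p, forall l s, gamma l s <> y.
Proof.
move=> np; apply: filter_forall => l.
have : nbhs p (~` range (gamma l)).
  apply: open_nbhs_nbhs; split; first by rewrite openC; exact: loop_image_closed.
  by move=> [s _ /np].
by apply: filterS => y ny s sy; apply: ny; exists s.
Qed.

Lemma near_chart_open (i : chart_index A) p (W : set M) : chart_dom i p -> nbhs p W ->
  exists O : set 'rV[R]_m, [/\ open O, O (chart i p) &
    forall y, chart_dom i y -> O (chart i y) -> W y].
Proof.
move=> ip nW.
exists (chart i @` (chart_dom i `&` interior W)); split.
- exact/chart_image_open/open_interior.
- by exists p.
- move=> y iy [z [iz /interior_subset Wz] zy].
  by rewrite -(chartK iy) -zy chartK.
Qed.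

Variable f : 'I_n -> R -> R.
Hypothesis f_smooth : forall j, @smooth_on R R^o R^o setT (f j).
Hypothesis f_per : forall j t, f j (t + T j) = f j t.

(* [d.1] is a bump function at [p], and [d.2] its product with a local extension
   of [f]: near a point of a loop, the parameter is a smooth function of one of
   the chart coordinates. *)
Lemma local_extension p : exists2 d : (M -> R) * (M -> R),
  [/\ smooth_fun A d.1, smooth_fun A d.2, forall x, 0 <= d.1 x &
      forall j t, d.2 (gamma j t) = d.1 (gamma j t) * f j t] & 0 < d.1 p.
Proof.
pose i := chart_at A p; have ip : chart_dom i p := chart_at_dom A p.
have [[j [t0 tp]]|np] := pselect (exists j t, gamma j t = p); last first.
  have np' : forall l s, gamma l s <> p by move=> l s lsp; apply: np; exists l, s.
  have [Q [oQ Qp QW]] := near_chart_open ip (near_no_loop np').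
  have [chi [Schi chi0 chip chiQ _]] := chart_bump hM ip oQ Qp.
  exists (chi, fun=> 0) => //=; split=> //; first exact: smooth_fun_cst.
  move=> l s; have [->|/chiQ[is_ Qs]] := eqVneq (chi (gamma l s)) 0.
    by rewrite mul0r.
  by have := QW _ is_ Qs l s erefl.
have [_ /(_ t0) v0 _ _] := gamma_emb j.
have it0 : chart_dom i (gamma j t0) by rewrite tp.
(* The loop is an immersion, so some chart coordinate [a] has non-zero speed at [t0], and near [t0]
   the parameter is a smooth function [tau] of that coordinate. *)
have [a va] : exists a, ('D_1 (chart i \o gamma j : R^o -> _) t0) ord0 a != 0.
  apply/existsP; apply: contra_neqT v0 => /existsPn v0.
  apply/rowP => a; have := v0 a; rewrite negbK => /eqP.
  by rewrite /velocity derive1E tp mxE.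
have Sj := gamma_smooth j; have [cc Sc] := Sj.
pose c : R^o -> R^o := fun t => chart i (gamma j t) ord0 a.
have oT := open_chart_time (i := i) cc.
have cS : smooth_on [set t : R^o | chart_dom i (gamma j t)] c.
  by move=> k; exact: (Ck_on_entry _ _ oT (Sc i k)).
have dc0 : 'D_1 c t0 != 0.
  by rewrite /c (@derive_entry R R^o _ _ (chart i \o gamma j)) //; exact: curve_diff.
have [e [J [tau [e0 oJ Stau tauK]]]] := local_inverse oT it0 cS dc0.
have [Q [oQ Qp QW]] := near_chart_open ip (near_loops tp e0).
(* [Q] keeps away everything but the arc around [t0]; the second condition keeps the coordinate [a]
   where [tau] is smooth. *)
pose Q' := Q `&` [set y : 'rV[R]_m | J (y ord0 a)].
have oQ' : open Q'.
  apply: openI => //; apply: (@open_comp _ _ (fun y : 'rV[R]_m => y ord0 a : R^o)) => //.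
  by move=> y _; exact: coord_continuous.
have Q'p : Q' (chart i p).
  by split=> //=; have [|_ Jt _] := tauK t0; rewrite ?subrr ?normr0 // -tp.
have [chi [Schi chi0 chip chiQ chiG]] := chart_bump hM ip oQ' Q'p.
pose G (y : 'rV[R]_m) : R^o := f j (tau (y ord0 a)).
exists (chi, fun y => chi y * G (chart i y)) => //=; split=> //.
  apply: chiG => k.
  have oO : open (Q' `&` chart i @` chart_dom i).
    by apply: openI => //; exact: chart_img_open.
  apply: (@Ck_on_comp1 R _ k _ setT (fun y : 'rV[R]_m => tau (y ord0 a) : R^o) (f j)) => //;
    last exact: f_smooth.
  apply: (@Ck_on_comp1 R _ k _ J (fun y : 'rV[R]_m => y ord0 a : R^o) tau) => //.
    by move=> y [[]].
  exact: Ck_on_coord.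
move=> l s; have [->|/chiQ[is_ [Qs _]]] := eqVneq (chi (gamma l s)) 0.
  by rewrite !mul0r.
congr (_ * _); have [lj [k sk]] := QW _ is_ Qs l s erefl; move: is_; rewrite lj => is_.
have [_ _ per] := (let: And4 H _ _ _ := gamma_emb j in H).
(* The parameter [s] is close to [t0] only modulo the period; [tau] recovers its representative [t],
   at which [f j] has the same value. *)
pose t := s + (- k)%:~R * T j.
have Es : gamma j s = gamma j t by rewrite /t periodicz.
have [|it Jt tK] := tauK t.
  by move: sk; rewrite /t mulrNz mulNr opprD addrA addrAC.
by rewrite /G Es -[chart _ _ _ _]/(c t) tK /t periodicz.
Qed.

(** The extension is the sum of the local extensions divided by the sum [S] of the bumps: along the
    loops the numerator is [S] times [f]. *)
Lemma extend_periodic : exists2 F : M -> R, smooth_fun A F &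
  forall j t, F (gamma j t) = f j t.
Proof.
pose P (d : (M -> R) * (M -> R)) := [/\ smooth_fun A d.1, smooth_fun A d.2,
  forall x, 0 <= d.1 x &
  forall j t, d.2 (gamma j t) = d.1 (gamma j t) * f j t].
have [|d [s [dP scov]]] := @finite_positive_family _ P (fun d => d.1) _ local_extension.
  by move=> d [Sd _ _ _]; exact: smooth_fun_continuous.
pose S x := \sum_(p <- s) (d p).1 x.
have S0 x : S x != 0.
  rewrite gt_eqF // /S; have [p ps dp] := scov x.
  rewrite (big_rem p) //= ltr_pwDl //; apply: sumr_ge0 => q _.
  by have [_ _ d0 _] := dP q; exact: d0.
have SS : smooth_fun A S by apply: smooth_fun_sum => p; have [] := dP p.
exists (fun x => (\sum_(p <- s) (d p).2 x) * (S x)^-1).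
  apply: smooth_funM; last exact: smooth_funV.
  by apply: smooth_fun_sum => p; have [] := dP p.
move=> j t; apply: (mulIf (S0 (gamma j t))); rewrite divfK // mulrC mulr_suml.
by apply: eq_bigr => p _; have [_ _ _ ->] := dP p.
Qed.

End Extension.

(** * Functions with spanning differentials *)

Section Immersion.
Context (R : realType) (m : nat) (M : topologicalType) (A : smooth_atlas R m M).
Hypothesis hM : hausdorff_space M.
Hypothesis cM : compact [set: M].
Implicit Types (i j : chart_index A) (F G : M -> R).

Lemma derive_comp0 (U V W : normedModType R) (f : U -> V) (g : V -> W) a v :
  differentiable f a -> differentiable g (f a) -> 'D_v f a = 0 ->
  'D_v (g \o f) a = 0.
Proof.
move=> df dg fv; rewrite deriveE; last exact: differentiable_comp.
by rewrite diff_comp //= -(deriveE _ df) fv linear0.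
Qed.

(** Going to the chart [j] and back is the identity near [chart i x], so its derivative along [v] is
    [v]; by the chain rule it is also 0. *)
Lemma transition_jac_inj i j x (v : 'rV[R]_m) :
  chart_dom i x -> chart_dom j x -> v *m transition_jac i j x = 0 -> v = 0.
Proof.
move=> ix jx v0; have dij := transition_diff ix jx; have dji := transition_diff jx ix.
have dji' : differentiable (chart i \o chart_inv j)
    ((chart j \o chart_inv i) (chart i x)) by rewrite /= chartK.
transitivity ('D_v ((chart i \o chart_inv j) \o (chart j \o chart_inv i))
    (chart i x)).
  rewrite -[LHS](derive_id (chart i x)); apply: near_eq_derive.
  have jn : nbhs x (chart_dom j) by apply: open_nbhs_nbhs; split=> //; exact: chart_dom_open.
  apply: filterS (filterI (near_chart_inv ix jn) (near_chart_img ix)).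
  by move=> y [jy [z iz zy]] /=; rewrite chartK // -zy chartK.
apply: (derive_comp0 dij dji').
by rewrite deriveEjacobian; [exact: v0|exact: dij].
Qed.

Definition dir_deriv i x (v : 'rV[R]_m) F : R := (v *m (diff_row i F x)^T) ord0 ord0.

Lemma dir_derivE i x v F : dir_deriv i x v F = \sum_k v ord0 k * partial i k F x.
Proof. by rewrite /dir_deriv mxE; apply: eq_bigr => k _; rewrite !mxE. Qed.

Lemma dir_deriv_transition i j x v F : smooth_in_chart j F ->
  chart_dom i x -> chart_dom j x ->
  dir_deriv i x v F = dir_deriv j x (v *m transition_jac i j x) F.
Proof.
move=> SF ix jx; rewrite /dir_deriv (diff_row_transition SF ix jx).
by rewrite trmx_mul trmxK mulmxA.
Qed.

Lemma dir_derivM i x v F G : smooth_in_chart i F -> smooth_in_chart i G ->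
  chart_dom i x -> dir_deriv i x v (fun y => F y * G y) =
    F x * dir_deriv i x v G + G x * dir_deriv i x v F.
Proof.
move=> SF SG ix; rewrite !dir_derivE !mulr_sumr -big_split /=.
by apply: eq_bigr => k _; rewrite partialM //; ring.
Qed.

Lemma dir_derivD i x v F G : smooth_in_chart i F -> smooth_in_chart i G ->
  chart_dom i x -> dir_deriv i x v (fun y => F y + G y) =
    dir_deriv i x v F + dir_deriv i x v G.
Proof.
move=> SF SG ix; rewrite !dir_derivE -big_split /=.
by apply: eq_bigr => k _; rewrite partialD // mulrDr.
Qed.

Lemma dir_deriv_cst i x v (a : R) : dir_deriv i x v (fun=> a) = 0.
Proof. by rewrite dir_derivE big1 // => k _; rewrite partial_cst mulr0. Qed.

Lemma dir_deriv_velocity F (c : R -> M) t : smooth_fun A F -> smooth_curve A c ->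
  dir_deriv (chart_at A (c t)) (c t) (velocity A c t) F =
    'D_1 (F \o c : R^o -> R^o) t.
Proof.
move=> SF Sc; have it := chart_at_dom A (c t).
have [_ ->] := smooth_in_chart_comp_curve (SF _) Sc it.
by rewrite dir_derivE; apply: eq_bigr => k _; rewrite mulrC /velocity derive1E.
Qed.

Lemma smooth_chart_coord i b : smooth_in_chart i (fun x => chart i x ord0 b).
Proof.
move=> k; apply: Ck_on_eq (Ck_on_coord k _ ord0 b); first exact: chart_img_open.
by move=> _ [x ix <-] /=; rewrite chartK.
Qed.

Lemma dir_deriv_chart_coord i x v b : chart_dom i x ->
  dir_deriv i x v (fun x => chart i x ord0 b) = v ord0 b.
Proof.
move=> ix; rewrite dir_derivE (bigD1 b) //= big1 => [|k kb].
  rewrite addr0 -[RHS]mulr1; congr (_ * _).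
  transitivity ('D_(delta_mx ord0 b) (fun y : 'rV[R]_m => y ord0 b : R^o) (chart i x)).
    apply: near_eq_derive; apply: filterS (near_chart_img ix).
    by move=> _ [z iz <-] /=; rewrite chartK.
  by rewrite (@derive_entry _ _ _ _ id) // derive_id mxE !eqxx.
transitivity (v ord0 k * 0); last by rewrite mulr0.
congr (_ * _).
transitivity ('D_(delta_mx ord0 k) (fun y : 'rV[R]_m => y ord0 b : R^o) (chart i x)).
  apply: near_eq_derive; apply: filterS (near_chart_img ix).
  by move=> _ [z iz <-] /=; rewrite chartK.
by rewrite (@derive_entry _ _ _ _ id) // derive_id mxE eq_sym (negbTE kb) andbF.
Qed.

(** The functions are finitely many bumps [chi] (index [None]) and their products with the chart
    coordinates (index [Some b]). If all differentials kill [v], then [dchi(v) = 0] leaves [chi(x)]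
    times each coordinate of [v] in the bump's chart, and [chi(x) > 0] at a suitable bump. *)
Lemma exists_immersion : exists (K : finType) (h : K -> M -> R),
  (forall k, smooth_fun A (h k)) /\
  forall i x, chart_dom i x -> forall v : 'rV[R]_m,
    (forall k, dir_deriv i x v (h k) = 0) -> v = 0.
Proof.
pose P (d : chart_index A * (M -> R)) := [/\ smooth_fun A d.2,
  forall y, 0 < d.2 y -> chart_dom d.1 y &
  forall b, smooth_fun A (fun y => d.2 y * chart d.1 y ord0 b)].
have [||d [s [dP scov]]] := @finite_positive_family R M cM _ P (fun d => d.2).
- by move=> d [Sd _ _]; exact: smooth_fun_continuous.
- move=> p; have ip := chart_at_dom A p; set i := chart_at A p in ip.
  have [chi [Schi _ chip chiO chiG]] :=
    chart_bump hM ip (chart_img_open (i := i)) (chart_img ip).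
  exists (i, chi) => //; split=> //= [y y0|b].
    by have [] := chiO y (lt0r_neq0 y0).
  by apply: (chiG (fun y => y ord0 b)) => k; exact: Ck_on_coord.
exists ('I_(size s) * option 'I_m)%type, (fun kb y =>
  let p := tnth (in_tuple s) kb.1 in
  if kb.2 is Some b then (d p).2 y * chart (d p).1 y ord0 b else (d p).2 y).
split=> [[k [b|]] /=|i x ix v vh].
- by have [_ _] := dP (tnth (in_tuple s) k); exact.
- by have [] := dP (tnth (in_tuple s) k).
have [p ps px] := scov x; have [Sp /(_ _ px) jx Spb] := dP p.
have [k kp] : exists k, tnth (in_tuple s) k = p.
  by have /tnthP[k ->] : p \in in_tuple s by []; exists k.
set j := (d p).1 in jx Spb.
apply: (transition_jac_inj ix jx); set w := v *m _.
have wE F : smooth_fun A F -> dir_deriv i x v F = 0 -> dir_deriv j x w F = 0.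
  by move=> SF; rewrite (dir_deriv_transition _ (SF j) ix jx).
have w0 : dir_deriv j x w (d p).2 = 0.
  by apply: wE => //; have := vh (k, None); rewrite /= kp.
apply/rowP => b; rewrite [RHS]mxE.
have := wE _ (Spb b); have := vh (k, Some b); rewrite /= kp => -> /(_ erefl).
rewrite dir_derivM //; last exact: smooth_chart_coord.
rewrite w0 mulr0 addr0 dir_deriv_chart_coord // => /eqP.
by rewrite mulf_eq0 gt_eqF //= => /eqP.
Qed.

End Immersion.

(** * One-forms and metrics built from functions *)

Section Forms.
Context (R : realType) (m : nat) (M : topologicalType) (A : smooth_atlas R m M).
Implicit Types (i j : chart_index A) (F G : M -> R).

Lemma row_dotC (u v : 'rV[R]_m) : (u *m v^T) ord0 ord0 = (v *m u^T) ord0 ord0.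
Proof. by rewrite !mxE; apply: eq_bigr => k _; rewrite !mxE mulrC. Qed.

Lemma outer_dot (u v a b : 'rV[R]_m) :
  (u *m (a^T *m b) *m v^T) ord0 ord0 =
  (u *m a^T) ord0 ord0 * (v *m b^T) ord0 ord0.
Proof. by rewrite mulmxA -mulmxA mxE big_ord1 (row_dotC b). Qed.

(** * One-forms that are sums of terms F dG *)

Section CombinationForm.
Context (Q : finType) (F G : Q -> M -> R).
Hypotheses (SF : forall q, smooth_fun A (F q)) (SG : forall q, smooth_fun A (G q)).

Let coef i x : 'rV[R]_m := \sum_q F q x *: diff_row i (G q) x.

Lemma combination_coefE i x k : coef i x ord0 k = \sum_q F q x * partial i k (G q) x.
Proof. by rewrite /coef summxE; apply: eq_bigr => q _; rewrite !mxE. Qed.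

Lemma combination_smooth i k : smooth_in_chart i (fun x => coef i x ord0 k).
Proof.
have -> : (fun x => coef i x ord0 k) =
    (fun x => \sum_q F q x * partial i k (G q) x).
  by apply/funext => x; exact: combination_coefE.
apply: smooth_in_chart_sum => q.
by apply: smooth_in_chartM; [exact: SF|apply: smooth_partial; exact: SG].
Qed.

Lemma combination_transform i j x : chart_dom i x -> chart_dom j x ->
  coef i x = coef j x *m (transition_jac i j x)^T.
Proof.
move=> ix jx; rewrite mulmx_suml; apply: eq_bigr => q _.
by rewrite (diff_row_transition (SG q j) ix jx) scalemxAl.
Qed.

Definition combination_form : one_form A :=
  {| form_smooth := combination_smooth; form_transform := combination_transform |}.

Lemma combination_formE i x v :
  (form_coef combination_form i x *m v^T) ord0 ord0 =
  \sum_q F q x * dir_deriv i x v (G q).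
Proof.
rewrite mulmx_suml summxE; apply: eq_bigr => q _.
by rewrite -scalemxAl mxE /dir_deriv row_dotC.
Qed.

(** Since [d(F dG)] is the wedge product of [dF] and [dG], only first derivatives survive: the
    second derivatives of [G] cancel by [partialC]. *)
Lemma combination_dform i x u v : chart_dom i x ->
  (u *m dform_coef combination_form i x *m v^T) ord0 ord0 =
  \sum_q (dir_deriv i x u (F q) * dir_deriv i x v (G q)
          - dir_deriv i x u (G q) * dir_deriv i x v (F q)).
Proof.
move=> ix.
have dE k l : partial i k (fun y => coef i y ord0 l) x =
    \sum_q (F q x * partial i k (partial i l (G q)) x
            + partial i l (G q) x * partial i k (F q) x).
  have -> : (fun y => coef i y ord0 l) =
      (fun y => \sum_q F q y * partial i l (G q) y).
    by apply/funext => y; exact: combination_coefE.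
  rewrite partial_sum //; last first.
    move=> q; apply: smooth_in_chartM; first exact: SF.
    by apply: smooth_partial; exact: SG.
  apply: eq_bigr => q _; rewrite partialM //; first exact: SF.
  by apply: smooth_partial; exact: SG.
have alg (f a b c d p p' : R) : p = p' ->
    f * p + a * b - (f * p' + c * d) = b * a - c * d by move=> ->; ring.
have DE : dform_coef combination_form i x =
    \sum_q ((diff_row i (F q) x)^T *m diff_row i (G q) x
            - (diff_row i (G q) x)^T *m diff_row i (F q) x).
  apply/matrixP => k l; rewrite mxE /= !dE -sumrB summxE.
  apply: eq_bigr => q _; rewrite !mxE !big_ord1 !mxE.
  exact: alg (partialC k l (SG q i) ix).
rewrite DE mulmx_sumr mulmx_suml summxE; apply: eq_bigr => q _.
have subE (X Y : 'M[R]_1) : (X - Y) ord0 ord0 = X ord0 ord0 - Y ord0 ord0.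
  by rewrite !mxE.
by rewrite /dir_deriv mulmxBr mulmxBl subE !outer_dot.
Qed.

End CombinationForm.

(** * One-forms dh - e a *)

Section CorrectedForm.
Context (a : one_form A) (h e : M -> R).
Hypotheses (Sh : smooth_fun A h) (Se : smooth_fun A e).

Let coef i x : 'rV[R]_m := diff_row i h x - e x *: form_coef a i x.

Lemma corrected_smooth i k : smooth_in_chart i (fun x => coef i x ord0 k).
Proof.
have -> : (fun x => coef i x ord0 k) =
    (fun x => partial i k h x + (-1 * e x) * form_coef a i x ord0 k).
  by apply/funext => x; rewrite !mxE mulN1r mulNr.
apply: smooth_in_chartD; first by apply: smooth_partial; exact: Sh.
apply: smooth_in_chartM; last exact: form_smooth.
by apply: smooth_in_chartM; [exact: smooth_fun_cst|exact: Se].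
Qed.

Lemma corrected_transform i j x : chart_dom i x -> chart_dom j x ->
  coef i x = coef j x *m (transition_jac i j x)^T.
Proof.
move=> ix jx; rewrite /coef (diff_row_transition (Sh j) ix jx).
by rewrite (form_transform a ix jx) mulmxBl scalemxAl.
Qed.

Definition corrected_form : one_form A :=
  {| form_smooth := corrected_smooth; form_transform := corrected_transform |}.

Lemma corrected_formE i x v :
  (form_coef corrected_form i x *m v^T) ord0 ord0 =
  dir_deriv i x v h - e x * (form_coef a i x *m v^T) ord0 ord0.
Proof.
rewrite /= mulmxBl -scalemxAl /dir_deriv (row_dotC v).
by rewrite [LHS]mxE [X in _ + X]mxE [X in - X]mxE.
Qed.

End CorrectedForm.

(** * Metrics that are sums of squares of one-forms *)

Section SumOfSquares.
Context (Q : finType) (theta : Q -> one_form A).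
Hypothesis theta_inj : forall i x, chart_dom i x -> forall v : 'rV[R]_m,
  (forall q, (form_coef (theta q) i x *m v^T) ord0 ord0 = 0) -> v = 0.

Let coef i x : 'M[R]_m :=
  \sum_q (form_coef (theta q) i x)^T *m form_coef (theta q) i x.

Lemma sum_squaresE i x (u v : 'rV[R]_m) : (u *m coef i x *m v^T) ord0 ord0 =
  \sum_q (form_coef (theta q) i x *m u^T) ord0 ord0 *
         (form_coef (theta q) i x *m v^T) ord0 ord0.
Proof.
rewrite mulmx_sumr mulmx_suml summxE; apply: eq_bigr => q _.
by rewrite outer_dot row_dotC (row_dotC v).
Qed.

Lemma sum_squares_smooth i k l : smooth_in_chart i (fun x => coef i x k l).
Proof.
have -> : (fun x => coef i x k l) = (fun x => \sum_q
    form_coef (theta q) i x ord0 k * form_coef (theta q) i x ord0 l).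
  apply/funext => x; rewrite summxE; apply: eq_bigr => q _.
  by rewrite mxE big_ord1 mxE.
by apply: smooth_in_chart_sum => q; apply: smooth_in_chartM; exact: form_smooth.
Qed.

Lemma sum_squares_sym i x : chart_dom i x -> (coef i x)^T = coef i x.
Proof.
by move=> _; rewrite raddf_sum; apply: eq_bigr => q _ /=; rewrite trmx_mul trmxK.
Qed.

Lemma sum_squares_posdef i x : chart_dom i x -> forall u : 'rV[R]_m,
  u != 0 -> 0 < (u *m coef i x *m u^T) ord0 ord0.
Proof.
move=> ix u u0; rewrite sum_squaresE lt_def sumr_ge0 ?andbT; last first.
  by move=> q _; rewrite -expr2 sqr_ge0.
apply: contra_neqN u0; rewrite psumr_eq0; last first.
  by move=> q _; rewrite -expr2 sqr_ge0.
move=> /allP u0; apply: (theta_inj ix) => q; apply/eqP.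
by have := u0 q (mem_index_enum q); rewrite /= mulf_eq0 orbb.
Qed.

Lemma sum_squares_transform i j x : chart_dom i x -> chart_dom j x ->
  coef i x = transition_jac i j x *m coef j x *m (transition_jac i j x)^T.
Proof.
move=> ix jx; rewrite mulmx_sumr mulmx_suml; apply: eq_bigr => q _.
by rewrite (form_transform (theta q) ix jx) trmx_mul trmxK !mulmxA.
Qed.

Definition sum_squares : riemannian_metric A :=
  Build_riemannian_metric sum_squares_smooth sum_squares_sym
    sum_squares_posdef sum_squares_transform.

End SumOfSquares.

End Forms.

(** * The one-form and the metric *)

Section Trig.
Context (R : realType).

Lemma is_derive_cos_scale (w t : R) :
  is_derive t 1 (fun s : R => cos (w * s)) (- w * sin (w * t)).
Proof.
have dl : is_derive t 1 (fun s : R => w * s) w.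
  apply: is_derive_eq (is_deriveZ w (is_derive_id t 1)) _.
  by rewrite -[LHS]/(w * 1) mulr1.
apply: is_derive_eq (is_derive1_comp (is_derive_cos (w * t)) dl) _; ring.
Qed.

Lemma is_derive_sin_scale (w t : R) :
  is_derive t 1 (fun s : R => sin (w * s)) (w * cos (w * t)).
Proof.
have dl : is_derive t 1 (fun s : R => w * s) w.
  apply: is_derive_eq (is_deriveZ w (is_derive_id t 1)) _.
  by rewrite -[LHS]/(w * 1) mulr1.
apply: is_derive_eq (is_derive1_comp (is_derive_sin (w * t)) dl) _; ring.
Qed.

Lemma smooth_trig (w : R) k :
  @Ck_on R R^o R^o k setT (fun s => cos (w * s)) /\
  @Ck_on R R^o R^o k setT (fun s => sin (w * s)).
Proof.
have dc t : differentiable ((fun s : R => cos (w * s)) : R^o -> R^o) t.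
  by apply/derivable1_diffP; have [] := is_derive_cos_scale w t.
have ds t : differentiable ((fun s : R => sin (w * s)) : R^o -> R^o) t.
  by apply/derivable1_diffP; have [] := is_derive_sin_scale w t.
elim: k => [|k [Cc Cs]].
  by split=> t _; apply: differentiable_continuous; [exact: dc|exact: ds].
split; apply: Ck_onS1; first exact: openT.
- by move=> t _; exact: dc.
- have -> : 'D_1 ((fun s : R => cos (w * s)) : R^o -> R^o) =
      (fun t : R => - w * sin (w * t)).
    by apply/funext => t; have [_ ->] := is_derive_cos_scale w t.
  by apply: Ck_on_mul; [exact: openT|exact: Ck_on_cst|].
- exact: openT.
- by move=> t _; exact: ds.
- have -> : 'D_1 ((fun s : R => sin (w * s)) : R^o -> R^o) =
      (fun t : R => w * cos (w * t)).
    by apply/funext => t; have [_ ->] := is_derive_sin_scale w t.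
  by apply: Ck_on_mul; [exact: openT|exact: Ck_on_cst|].
Qed.

Lemma derive_periodic (f : R^o -> R^o) (P t : R) : (forall s, f (s + P) = f s) ->
  'D_1 f (t + P) = 'D_1 f t.
Proof.
move=> fP; rewrite /derive.
have -> : (fun h => h^-1 *: ((f \o shift (t + P)) (h *: (1 : R^o)) - f (t + P))) =
    (fun h => h^-1 *: ((f \o shift t) (h *: (1 : R^o)) - f t)); last by [].
by apply/funext => h /=; rewrite fP addrA fP.
Qed.

End Trig.

(** * A one-form equal to 1 on the velocities, with dalpha(gamma', .) = 0 *)

Section Construction.
Context (R : realType) (m : nat) (M : topologicalType) (A : smooth_atlas R m M).
Hypothesis hM : hausdorff_space M.
Hypothesis cM : compact [set: M].
Context (n : nat) (T : 'I_n -> R) (gamma : 'I_n -> R -> M).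
Hypothesis gamma_emb : forall i, embedded_loop A (T i) (gamma i).
Hypothesis gamma_disj : forall i j s t, gamma i s = gamma j t -> i = j.

Let w (j : 'I_n) : R := pi *+ 2 / T j.

Lemma period_gt0 j : 0 < T j.
Proof. by have [[]] := gamma_emb j. Qed.

Lemma wT j : w j * T j = pi *+ 2.
Proof. by rewrite /w divfK // gt_eqF // period_gt0. Qed.

(** The pair [(C, S)] is a map to the plane that wraps the loop [l] once around the unit circle and
    sends the other loops to the origin. *)
Lemma exists_circle_coordinates l : exists C S : M -> R,
  [/\ smooth_fun A C, smooth_fun A S &
      forall j t, C (gamma j t) = (if j == l then cos (w j * t) else 0) /\
                  S (gamma j t) = (if j == l then sin (w j * t) else 0)].
Proof.
have ext := extend_periodic hM cM gamma_emb gamma_disj.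
have [||C SC CE] := ext (fun j t => if j == l then cos (w j * t) else 0).
- move=> j k; case: eqP => _; last exact: Ck_on_cst.
  by have [] := smooth_trig (w j) k.
- by move=> j t; case: eqP => // _; rewrite mulrDr wT cosD2pi.
have [||S SS SE] := ext (fun j t => if j == l then sin (w j * t) else 0).
- move=> j k; case: eqP => _; last exact: Ck_on_cst.
  by have [] := smooth_trig (w j) k.
- by move=> j t; case: eqP => // _; rewrite mulrDr wT sinD2pi.
by exists C, S; split.
Qed.

(* Symmetry of second derivatives removes them from d(F dG), and the remaining
   terms of dalpha(gamma', v) add up to
   2 (C dC(v) + S dS(v)) (C^2 + S^2 - 1). *)
Lemma exists_dual_form : exists a : one_form A,
  (forall j t, form_at a (gamma j t) (velocity A (gamma j) t) = 1) /\
  (forall j t v, dform_at a (gamma j t) (velocity A (gamma j) t) v = 0).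
Proof.
have [C /choice[S CS]] := choice exists_circle_coordinates.
have SC l : smooth_fun A (C l) by have [] := CS l.
have SS l : smooth_fun A (S l) by have [] := CS l.
pose rho l x := 2 + -1 * (C l x * C l x + S l x * S l x).
have Srho l : smooth_fun A (rho l).
  apply: smooth_funD; first exact: smooth_fun_cst.
  apply: smooth_funM; first exact: smooth_fun_cst.
  by apply: smooth_funD; apply: smooth_funM.
(* The index [(l, true)] carries the term in [C_l dS_l] and [(l, false)] the one in [- S_l dC_l];
   the factor [(w l)^-1] is [T_l / (2 pi)]. *)
pose F (q : 'I_n * bool) x := if q.2 then (w q.1)^-1 * (rho q.1 x * C q.1 x)
  else - (w q.1)^-1 * (rho q.1 x * S q.1 x).
pose G (q : 'I_n * bool) := if q.2 then S q.1 else C q.1.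
have SF q : smooth_fun A (F q).
  by case: q => l [] /=; apply: smooth_funM;
    [exact: smooth_fun_cst|apply: smooth_funM|exact: smooth_fun_cst|apply: smooth_funM].
have SG q : smooth_fun A (G q) by case: q => l []; [exact: SS|exact: SC].
exists (combination_form SF SG).
have w0 j : w j != 0.
  by rewrite mulf_neq0 // ?invr_neq0 ?gt_eqF ?period_gt0 // mulrn_wgt0 ?pi_gt0.
have Sg j := gamma_smooth gamma_emb j.
have dC j l t : dir_deriv (chart_at A (gamma j t)) (gamma j t)
    (velocity A (gamma j) t) (C l) =
    if j == l then - w j * sin (w j * t) else 0.
  rewrite dir_deriv_velocity //.
  have -> : C l \o gamma j = fun t => if j == l then cos (w j * t) else 0.
    by apply/funext => s; have [_ _ /(_ j s)[]] := CS l.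
  case: eqP => _; last exact: (derive_cst (0 : R^o)).
  by have [_ ->] := is_derive_cos_scale (w j) t.
have dS j l t : dir_deriv (chart_at A (gamma j t)) (gamma j t)
    (velocity A (gamma j) t) (S l) =
    if j == l then w j * cos (w j * t) else 0.
  rewrite dir_deriv_velocity //.
  have -> : S l \o gamma j = fun t => if j == l then sin (w j * t) else 0.
    by apply/funext => s; have [_ _ /(_ j s)[]] := CS l.
  case: eqP => _; last exact: (derive_cst (0 : R^o)).
  by have [_ ->] := is_derive_sin_scale (w j) t.
have CE j l t : C l (gamma j t) = if j == l then cos (w j * t) else 0.
  by have [_ _ /(_ j t)[]] := CS l.
have SE j l t : S l (gamma j t) = if j == l then sin (w j * t) else 0.
  by have [_ _ /(_ j t)[]] := CS l.
have cs (x : R) : cos x * cos x + sin x * sin x = 1.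
  by rewrite -!expr2 cos2Dsin2.
have sumQ (f : 'I_n * bool -> R) : \sum_q f q = \sum_l (f (l, true) + f (l, false)).
  transitivity (\sum_q f (q.1, q.2)); first by apply: eq_bigr => -[].
  rewrite -(pair_bigA _ (fun l b => f (l, b))) /=; apply: eq_bigr => l _.
  by rewrite big_bool.
split=> [j t|j t v].
  rewrite /form_at combination_formE sumQ (bigD1 j) //= big1 => [|l /negbTE lj].
    rewrite addr0 /F /G /= dC dS /rho !CE !SE eqxx cs.
    rewrite mulN1r -[X in _ = X](cs (w j * t)).
    by field; exact: w0.
  by rewrite /F /G /= dC dS eq_sym lj !mulr0 addr0.
rewrite /dform_at combination_dform; last exact: chart_at_dom.
set x := gamma j t; set i := chart_at A x.
have ix : chart_dom i x := chart_at_dom A x.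
set u := velocity A (gamma j) t.
have cst (r : R) : smooth_fun A (fun=> r) by exact: smooth_fun_cst.
have dM z F1 G1 (S1 : smooth_fun A F1) (S2 : smooth_fun A G1) :=
  dir_derivM z (S1 i) (S2 i) ix.
have dD z F1 G1 (S1 : smooth_fun A F1) (S2 : smooth_fun A G1) :=
  dir_derivD z (S1 i) (S2 i) ix.
have drho (z : 'rV[R]_m) l : dir_deriv i x z (rho l) =
    - 2 * (C l x * dir_deriv i x z (C l) + S l x * dir_deriv i x z (S l)).
  have SCC : smooth_fun A (fun y => C l y * C l y) by exact: smooth_funM.
  have SSS : smooth_fun A (fun y => S l y * S l y) by exact: smooth_funM.
  have SCS := smooth_funD SCC SSS.
  rewrite /rho (dD _ _ _ (cst _) (smooth_funM (cst _) SCS)) (dM _ _ _ (cst _) SCS).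
  rewrite (dD _ _ _ SCC SSS) (dM _ _ _ (SC l) (SC l)) (dM _ _ _ (SS l) (SS l)).
  by rewrite !dir_deriv_cst; ring.
have dFt (y : 'rV[R]_m) l : dir_deriv i x y (F (l, true)) = (w l)^-1 *
    (rho l x * dir_deriv i x y (C l) + C l x * dir_deriv i x y (rho l)).
  rewrite (dM _ _ _ (cst _) (smooth_funM (Srho l) (SC l))) dir_deriv_cst.
  by rewrite (dM _ _ _ (Srho l) (SC l)) mulr0 addr0.
have dFf (y : 'rV[R]_m) l : dir_deriv i x y (F (l, false)) = - (w l)^-1 *
    (rho l x * dir_deriv i x y (S l) + S l x * dir_deriv i x y (rho l)).
  rewrite (dM _ _ _ (cst _) (smooth_funM (Srho l) (SS l))) dir_deriv_cst.
  by rewrite (dM _ _ _ (Srho l) (SS l)) mulr0 addr0.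
(* For [l] other than [j], the functions [C_l], [S_l] and their derivatives along the loop [j]
   vanish, so only the term of index [j] remains. *)
rewrite sumQ (bigD1 j) //= big1 => [|l /negbTE lj]; last first.
  rewrite !dFt !dFf /G /= !drho [dir_deriv i x u (C l)]dC [dir_deriv i x u (S l)]dS.
  by rewrite /x !CE !SE eq_sym lj; ring.
rewrite !dFt !dFf /G /= !drho [dir_deriv i x u (C j)]dC [dir_deriv i x u (S j)]dS.
rewrite /rho /x !CE !SE eqxx cs.
set dc := dir_deriv _ _ v (C j); set ds := dir_deriv _ _ v (S j).
transitivity (2 * (cos (w j * t) * dc + sin (w j * t) * ds) *
  (cos (w j * t) * cos (w j * t) + sin (w j * t) * sin (w j * t) - 1)).
  by field; exact: w0.
by rewrite cs subrr mulr0.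
Qed.

End Construction.

(** * A metric for which the velocities are dual to the one-form *)

Section DualPair.
Context (R : realType) (m : nat) (M : topologicalType) (A : smooth_atlas R m M).
Context (n : nat) (T : 'I_n -> R) (gamma : 'I_n -> R -> M).

(** These conditions depend only on the germs of [g] and [a] along the loops; maximality, which is
    global, is kept apart. *)
Definition dual_pair_along (g : riemannian_metric A) (a : one_form A) : Prop :=
  forall j t, [/\ form_at a (gamma j t) (velocity A (gamma j) t) = 1,
    forall v, dform_at a (gamma j t) (velocity A (gamma j) t) v = 0 &
    forall v, metric_at g (gamma j t) (velocity A (gamma j) t) v =
              form_at a (gamma j t) v].

Hypothesis hM : hausdorff_space M.
Hypothesis cM : compact [set: M].
Hypothesis gamma_emb : forall i, embedded_loop A (T i) (gamma i).
Hypothesis gamma_disj : forall i j s t, gamma i s = gamma j t -> i = j.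

Lemma exists_dual_pair : exists (g : riemannian_metric A) (a : one_form A),
  dual_pair_along g a /\
  forall x v, form_at a x v ^+ 2 <= metric_at g x v v.
Proof.
have [a [a1 da]] := exists_dual_form hM cM gamma_emb gamma_disj.
have [K [h [Sh h_inj]]] := exists_immersion A hM cM.
have Sg j := gamma_smooth gamma_emb j.
(* The choice of [e k] makes [dh_k - e_k alpha] vanish on the velocities, since [alpha] is 1
   there. *)
have /choice[e Pe] : forall k, exists F : M -> R, smooth_fun A F /\
    forall j t, F (gamma j t) = 'D_1 (h k \o gamma j : R^o -> R^o) t.
  move=> k.
  have Shg j := smooth_comp_curve (Sh k) (Sg j).
  have [||F SF FE] := extend_periodic hM cM gamma_emb gamma_disj
    (f := fun j => 'D_1 (h k \o gamma j : R^o -> R^o)).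
  - by move=> j p; have [_] := Shg j p.+1; exact.
  - move=> j t; apply: derive_periodic => s /=.
    by have [[_ _ ->]] := gamma_emb j.
  by exists F.
have Se k : smooth_fun A (e k) by have [] := Pe k.
pose theta (q : unit + K) : one_form A :=
  if q is inr k then corrected_form a (Sh k) (Se k) else a.
(* A vector killed by [alpha] and by all the [dh_k - e_k alpha] is killed by all the [dh_k], which
   span. *)
have theta_inj i x : chart_dom i x -> forall v : 'rV[R]_m,
    (forall q, (form_coef (theta q) i x *m v^T) ord0 ord0 = 0) -> v = 0.
  move=> ix v v0; apply: (h_inj i x ix) => k.
  have := v0 (inr k); rewrite corrected_formE.
  by have /= -> := v0 (inl tt); rewrite mulr0 subr0.
pose g := sum_squares theta_inj.
have gE x u v : metric_at g x u v = form_at a x u * form_at a x v +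
    \sum_k form_at (theta (inr k)) x u * form_at (theta (inr k)) x v.
  rewrite /metric_at sum_squaresE big_sumType /= (bigD1 tt) //=.
  by rewrite [X in _ + X + _]big1 ?addr0 // => -[].
exists g, a; split=> [j t|x v].
  split=> // v; rewrite gE a1 mul1r big1 ?addr0 // => k _.
  rewrite [X in X * _]corrected_formE [form_coef a _ _ *m _]/=.
  rewrite dir_deriv_velocity // -[X in _ - _ * X]/(form_at a _ _) a1 mulr1.
  by have [_ ->] := Pe k; rewrite subrr mul0r.
rewrite gE expr2 lerDl; apply: sumr_ge0 => k _.
by rewrite -expr2 sqr_ge0.
Qed.

End DualPair.

(** * Norms and the critical value *)

Section Norms.
Context (R : realType) (m : nat) (M : topologicalType) (A : smooth_atlas R m M).
Implicit Types (g : riemannian_metric A) (a : one_form A).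

Definition form_sqnorm g a x : R :=
  (form_coef a (chart_at A x) x *m invmx (metric_coef g (chart_at A x) x)
     *m (form_coef a (chart_at A x) x)^T) ord0 ord0.

Definition dual_vector g a x : 'rV[R]_m :=
  form_coef a (chart_at A x) x *m invmx (metric_coef g (chart_at A x) x).

Lemma metric_at_ge0 g x v : 0 <= metric_at g x v v.
Proof.
have [->|v0] := eqVneq v 0; first by rewrite /metric_at !mul0mx mxE.
exact/ltW/(metric_posdef g (chart_at_dom A x) v0).
Qed.

Lemma dual_vectorP g a x v : metric_at g x (dual_vector g a x) v = form_at a x v.
Proof.
rewrite /metric_at /form_at /dual_vector -[X in (X *m _) _ _]mulmxA mulVmx ?mulmx1 //.
exact/metric_coef_unit/chart_at_dom.
Qed.

Lemma metric_at_sym g x u v : metric_at g x u v = metric_at g x v u.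
Proof.
rewrite /metric_at -{2}(Defs.metric_sym g (chart_at_dom A x)).
have -> : v *m (metric_coef g (chart_at A x) x)^T *m u^T =
    (u *m metric_coef g (chart_at A x) x *m v^T)^T.
  by rewrite !trmx_mul trmxK mulmxA.
by rewrite [RHS]mxE.
Qed.

Lemma form_sqnormE g a x : form_sqnorm g a x = form_at a x (dual_vector g a x).
Proof. by rewrite /form_at row_dotC. Qed.

Lemma metric_atBl g x u v z :
  metric_at g x (u - v) z = metric_at g x u z - metric_at g x v z.
Proof. by rewrite /metric_at !mulmxBl [LHS]mxE [X in _ + X]mxE. Qed.

(* [g (v - w) (v - w) >= 0] for the vector [w] dual to [a]. *)
Lemma form_le_sqnorm g a x v :
  2 * form_at a x v - metric_at g x v v <= form_sqnorm g a x.
Proof.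
pose w := dual_vector g a x.
have := metric_at_ge0 g x (v - w).
rewrite metric_atBl ![metric_at g x _ (v - w)]metric_at_sym !metric_atBl.
rewrite (metric_at_sym g x w v) ![metric_at _ _ v w]metric_at_sym !dual_vectorP.
by rewrite form_sqnormE -/w; lra.
Qed.

Lemma form_normE g a x : form_norm g a x = Num.sqrt (form_sqnorm g a x).
Proof. by []. Qed.

Lemma form_norm_le1 g a x : (form_norm g a x <= 1) = (form_sqnorm g a x <= 1).
Proof. by rewrite form_normE -[X in _ <= X]sqrtr1 ler_sqrt. Qed.

(** With [N] the squared norm, the hypothesis at the dual vector reads [N^2 <= N]. *)
Lemma form_sqnorm_le1 g a x :
  (forall v, form_at a x v ^+ 2 <= metric_at g x v v) -> form_sqnorm g a x <= 1.
Proof.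
move=> /(_ (dual_vector g a x)); rewrite dual_vectorP -form_sqnormE => le_N.
have [N0|] := leP (form_sqnorm g a x) 0; first exact: le_trans N0 ler01.
by move=> N0; rewrite -(ler_pM2l N0) mulr1 -expr2.
Qed.

(** Positive definiteness forces [v] to be the dual vector: their difference has zero length. *)
Lemma form_sqnorm_dual g a x v : (forall u, metric_at g x v u = form_at a x u) ->
  form_sqnorm g a x = form_at a x v.
Proof.
move=> vP; rewrite form_sqnormE; congr (form_at _ _ _).
apply/eqP; rewrite -subr_eq0; apply/eqP/eqP; apply: contraT => w0.
have := metric_posdef g (chart_at_dom A x) w0.
rewrite -/(metric_at g x _ _) metric_atBl vP dual_vectorP subrr.
by rewrite ltxx.
Qed.

Context (n : nat) (T : 'I_n -> R) (gamma : 'I_n -> R -> M).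

Lemma dual_pair_norm1 g a j t : dual_pair_along gamma g a ->
  form_norm g a (gamma j t) = 1.
Proof.
by move=> /(_ j t)[a1 _ dual]; rewrite form_normE (form_sqnorm_dual dual) a1 sqrtr1.
Qed.

(** Agreement on an open set, rather than on the loops alone, is what carries over the partial
    derivatives in [dform_at]. *)
Lemma dual_pair_agree (U : set M) g a g' a' : open U ->
  (forall j t, U (gamma j t)) -> agree_on U g a g' a' ->
  dual_pair_along gamma g a -> dual_pair_along gamma g' a'.
Proof.
move=> oU Ug agr dp j t; have [a1 da dual] := dp j t.
set x := gamma j t in a1 da dual *; set i := chart_at A x.
have ix : chart_dom i x := chart_at_dom A x.
have [gE aE] := agr i x (Ug j t) ix.
have faE v : form_at a' x v = form_at a x v by rewrite /form_at aE.
split=> [|v|v].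
- by rewrite faE.
- apply: etrans (da v).
  have dE k l : partial i k (fun y => form_coef a' i y ord0 l) x =
      partial i k (fun y => form_coef a i y ord0 l) x.
    apply: partial_near => //.
    have nU : nbhs x U by apply: open_nbhs_nbhs; split=> //; exact: Ug.
    have ni : nbhs x (chart_dom i).
      by apply: open_nbhs_nbhs; split=> //; exact: chart_dom_open.
    by apply: filterS (filterI nU ni) => y [Uy iy]; have [_ ->] := agr i y Uy iy.
  rewrite /dform_at; have -> : dform_coef a' i x = dform_coef a i x; last by [].
  by apply/matrixP => k l; rewrite !mxE !dE.
- by rewrite faE -dual /metric_at gE.
Qed.

(* [inf] of a set that is not bounded below is 0, so the set defining [c0] need
   not be shown bounded below. *)
Lemma c0_le_half g a : (forall x, form_norm g a x <= 1) -> c0 g a <= 2^-1.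
Proof.
move=> le1; rewrite /c0; set E := [set _ | _].
have E2 : E 2^-1.
  move=> P c _ _; rewrite /action /Rintegral; apply: fine_ge0.
  apply: integral_ge0 => t _; rewrite lee_fin.
  have := form_le_sqnorm g a (c t) (velocity A c t).
  have := le1 (c t); rewrite form_norm_le1; lra.
have [hi|/inf_out ->] := pselect (has_inf E); last by rewrite invr_ge0.
by apply: ge_inf => //; have [] := hi.
Qed.

End Norms.

(** * Geodesic equation *)

Section Geodesic.
Context (R : realType) (m : nat) (M : topologicalType) (A : smooth_atlas R m M).
Implicit Types (i j : chart_index A) (F : M -> R) (c : R -> M).

Lemma derive_comp (U V W : normedModType R) (f : U -> V) (g : V -> W) x v :
  differentiable f x -> differentiable g (f x) ->
  'D_v (g \o f) x = 'D_('D_v f x) g (f x).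
Proof.
move=> df dg; rewrite deriveE; last exact: differentiable_comp.
by rewrite diff_comp //= -(deriveE _ df) -deriveE.
Qed.

Lemma curve_velocity_transition i j c t : smooth_curve A c ->
  chart_dom i (c t) -> chart_dom j (c t) ->
  'D_1 (chart j \o c : R^o -> 'rV[R]_m) t =
  'D_1 (chart i \o c : R^o -> 'rV[R]_m) t *m transition_jac i j (c t).
Proof.
move=> Sc it jt; have [cc _] := Sc.
have dij := transition_diff it jt.
transitivity ('D_1 ((chart j \o chart_inv i) \o (chart i \o c) : R^o -> _) t).
  apply: near_eq_derive; apply: filterS (near_chart_time cc it) => s is_ /=.
  by rewrite chartK.
rewrite (@derive_comp R^o _ _ (chart i \o c)) //; last exact: curve_diff.
by rewrite deriveEjacobian.
Qed.

Lemma mulmx_delta (u : 'rV[R]_m) k : (u *m (delta_mx ord0 k : 'rV[R]_m)^T) ord0 ord0 = u ord0 k.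
Proof. by rewrite trmx_delta -colE mxE. Qed.

Lemma opp_mulmxK (u v : 'rV[R]_m) (P : 'M[R]_m) :
  P \in unitmx -> v = - (u *m P) -> v *m invmx P = - u.
Proof. by move=> uP ->; rewrite mulNmx -mulmxA mulmxV // mulmx1. Qed.

(** Fermat's rule on the coordinate line through [chart i x]. *)
Lemma partial_local_max i k F x : smooth_in_chart i F -> chart_dom i x ->
  (\forall y \near x, F y <= F x) -> partial i k F x = 0.
Proof.
move=> SF ix Fmax; have [dF _] := SF 1.
have : \forall y \near chart i x,
    (chart i @` chart_dom i) y /\ F (chart_inv i y) <= F x.
  exact: filterI (near_chart_img ix) (near_chart_inv ix Fmax).
move=> /nbhs_ballP[e /= e0 He].
pose u : 'rV[R]_m := delta_mx ord0 k.
have ball_line (s : R) : s \in `](- e), e[%R -> ball (chart i x) e (s *: u + chart i x).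
  rewrite in_itv /= -ltr_norml => se; split=> // p q.
  rewrite /ball /= !mxE opprD addrCA subrr addr0 normrN normrM.
  apply: le_lt_trans se; rewrite ler_piMr //.
  by case: (_ && _); rewrite ?normr1 ?normr0.
have dline s : s \in `](- e), e[%R -> is_derive s 1
    (fun s : R => (F \o chart_inv i : _ -> R^o) (s *: u + chart i x))
    ('D_u (F \o chart_inv i : _ -> R^o) (s *: u + chart i x)).
  move=> se; apply: (@is_derive_line _ _ R^o (F \o chart_inv i)).
  by apply: dF; exact: (He _ (ball_line s se)).1.
have z0 : 0 \in `](- e), e[%R by rewrite in_itv /= oppr_lt0 e0.
have [||||_] := @derive1_at_max R (fun s : R => (F \o chart_inv i) (s *: u + chart i x))
  (- e) e 0.
- by rewrite ge0_cp // ltW.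
- by move=> s se; have [] := dline s se.
- exact: z0.
- move=> s se; rewrite scale0r add0r /= chartK //.
  exact: (He _ (ball_line s se)).2.
have [_ ->] := dline 0 z0; rewrite scale0r add0r; exact.
Qed.

Context (g : riemannian_metric A) (a : one_form A) (c : R -> M).
Hypothesis Sc : smooth_curve A c.
Hypothesis c_dual : forall t v, metric_at g (c t) (velocity A c t) v = form_at a (c t) v.
Hypothesis c_dform : forall t v, dform_at a (c t) (velocity A c t) v = 0.
Hypothesis c_unit : forall t, form_at a (c t) (velocity A c t) = 1.
Hypothesis norm_le1 : forall x, form_sqnorm g a x <= 1.

(** The duality is given in the chart [chart_at A (c t)], which may jump with [t]. In a fixed chart
    it can be differentiated along [c]. *)
Lemma chart_dual i t : chart_dom i (c t) ->
  'D_1 (chart i \o c : R^o -> 'rV[R]_m) t *m metric_coef g i (c t) =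
  form_coef a i (c t).
Proof.
move=> it; set j := chart_at A (c t); have jt : chart_dom j (c t) := chart_at_dom A (c t).
rewrite (metric_transform g it jt) (form_transform a it jt) !mulmxA.
rewrite -curve_velocity_transition //; congr (_ *m _); apply/rowP => k.
have := c_dual t (delta_mx ord0 k).
by rewrite /metric_at /form_at !mulmx_delta /velocity derive1E.
Qed.

Lemma form_le_metric_chart i x (v : 'rV[R]_m) : chart_dom i x ->
  2 * (form_coef a i x *m v^T) ord0 ord0 - (v *m metric_coef g i x *m v^T) ord0 ord0 <= 1.
Proof.
move=> ix; set j := chart_at A x; have jx : chart_dom j x := chart_at_dom A x.
apply: le_trans (norm_le1 x).
apply: le_trans (form_le_sqnorm g a x (v *m transition_jac i j x)).
rewrite /form_at /metric_at -/j (metric_transform g ix jx) (form_transform a ix jx).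
by rewrite trmx_mul !mulmxA.
Qed.

(** The function [F] below is at most 1 near [c t] and equals 1 there, so its partial derivatives
    vanish. The vector [v] stays frozen in the coordinates of the chart [i]: only the tensor
    components are differentiated. *)
Lemma dual_first_order i k t : chart_dom i (c t) ->
  let v := 'D_1 (chart i \o c : R^o -> 'rV[R]_m) t in
  \sum_b \sum_d v ord0 b * v ord0 d *
     partial i k (fun y => metric_coef g i y b d) (c t) =
  2 * \sum_b v ord0 b * partial i k (fun y => form_coef a i y ord0 b) (c t).
Proof.
move=> it v.
pose F y := \sum_b (2 * v ord0 b) * form_coef a i y ord0 b +
  \sum_b \sum_d (- (v ord0 b * v ord0 d)) * metric_coef g i y b d.
have FE y : F y = 2 * (form_coef a i y *m v^T) ord0 ord0 -
    (v *m metric_coef g i y *m v^T) ord0 ord0.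
  rewrite /F; congr (_ + _).
    by rewrite mxE mulr_sumr; apply: eq_bigr => b _; rewrite mxE; ring.
  rewrite mxE -sumrN exchange_big /=; apply: eq_bigr => d _.
  rewrite !mxE mulr_suml -sumrN; apply: eq_bigr => b _; ring.
have cst (r : R) : smooth_in_chart i (fun=> r) by exact: smooth_fun_cst.
have S1 b : smooth_in_chart i (fun y => (2 * v ord0 b) * form_coef a i y ord0 b).
  by apply: smooth_in_chartM; [exact: cst|exact: form_smooth].
have S2 b d : smooth_in_chart i
    (fun y => (- (v ord0 b * v ord0 d)) * metric_coef g i y b d).
  by apply: smooth_in_chartM; [exact: cst|exact: metric_smooth].
have S3 b : smooth_in_chart i
    (fun y => \sum_d (- (v ord0 b * v ord0 d)) * metric_coef g i y b d).
  exact: smooth_in_chart_sum.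
have SF : smooth_in_chart i F.
  by apply: smooth_in_chartD; exact: smooth_in_chart_sum.
have : partial i k F (c t) = 0.
  apply: partial_local_max => //.
  have -> : F (c t) = 1.
    rewrite FE /v chart_dual //.
    set j := chart_at A (c t); have jt : chart_dom j (c t) := chart_at_dom A (c t).
    have -> : (form_coef a i (c t) *m v^T) ord0 ord0 = 1; last by ring.
    rewrite (form_transform a it jt) -mulmxA -trmx_mul -curve_velocity_transition //.
    by have := c_unit t; rewrite /form_at /velocity derive1E.
  have : nbhs (c t) (chart_dom i).
    by apply: open_nbhs_nbhs; split=> //; exact: chart_dom_open.
  by apply: filterS => y iy; rewrite FE; exact: form_le_metric_chart.
rewrite partialD //; [|exact: smooth_in_chart_sum|exact: smooth_in_chart_sum].
rewrite !partial_sum // => /eqP; rewrite addr_eq0 => /eqP E.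
rewrite mulr_sumr; transitivity
    (\sum_b partial i k (fun y => (2 * v ord0 b) * form_coef a i y ord0 b) (c t)).
  rewrite E -sumrN; apply: eq_bigr => b _; rewrite partial_sum // -sumrN.
  apply: eq_bigr => d _; rewrite partialM //; last exact: metric_smooth.
  by rewrite partial_cst; ring.
apply: eq_bigr => b _; rewrite partialM //; last exact: form_smooth.
by rewrite partial_cst; ring.
Qed.

(** This is the derivative along [c] of the identity [sum_b v_b g_bl = a_l] of [chart_dual]. *)
Lemma dual_along i l t : chart_dom i (c t) ->
  let v := 'D_1 (chart i \o c : R^o -> 'rV[R]_m) in
  \sum_b 'D_1 v t ord0 b * metric_coef g i (c t) b l +
  \sum_b \sum_d v t ord0 b * v t ord0 d *
     partial i d (fun y => metric_coef g i y b l) (c t) =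
  \sum_d v t ord0 d * partial i d (fun y => form_coef a i y ord0 l) (c t).
Proof.
move=> it v; have [cc Sci] := Sc.
have dv : differentiable v t by have [_ /(_ 1)[dv _]] := Sci i 2; exact: dv.
have dvb b := @differentiable_entry R R^o _ _ v ord0 b t dv.
pose G b := (fun y => metric_coef g i y b l) \o c.
have Gc b := smooth_in_chart_comp_curve (metric_smooth g i b l) Sc it.
have [da Ea] := smooth_in_chart_comp_curve (form_smooth a i l) Sc it.
have Eq : \forall s \near t,
    (\sum_b ((fun s => v s ord0 b : R^o) * (G b : R^o -> R^o))) s =
    ((fun y => form_coef a i y ord0 l) \o c) s.
  apply: filterS (near_chart_time cc it) => s is_ /=.
  rewrite -(chart_dual is_) mxE fct_sumE.
  by apply: eq_bigr => b _.
have := near_eq_derive (1 : R^o) Eq; rewrite Ea => {Eq}.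
rewrite derive_sum; last first.
  move=> b; apply: derivableM; apply: diff_derivable; first exact: dvb.
  by have [] := Gc b.
move=> E; rewrite -[RHS]/(\sum_d _); under [RHS]eq_bigr do rewrite mulrC.
rewrite -E -big_split /=; apply: eq_bigr => b _.
rewrite deriveM; last 2 first.
- exact/diff_derivable/dvb.
- by apply: diff_derivable; have [] := Gc b.
have [_ ->] := Gc b; rewrite derive_entry // addrC; congr (_ + _).
  rewrite -[RHS]/(_ * _) mulr_sumr; apply: eq_bigr => d _.
  by rewrite -mulrA [v t ord0 d * _]mulrC.
by rewrite -[RHS]/(_ * _) mulrC.
Qed.

(** Subtracting half of [dual_first_order] from [dual_along] leaves the geodesic equation with
    lowered index on the left, and [dalpha(v, e_l) = 0] on the right. *)
Lemma dual_geodesic t : covariant_acceleration g c t = 0.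
Proof.
set i := chart_at A (c t); have it : chart_dom i (c t) := chart_at_dom A (c t).
pose v := 'D_1 (chart i \o c : R^o -> 'rV[R]_m).
have vE : velocity A c t = v t by rewrite /velocity derive1E.
have wE : derive1n 2 (chart i \o c) t = 'D_1 v t.
  rewrite derive1nS derive1n1 derive1E; congr ('D_1 _ t).
  by apply/funext => s; rewrite derive1E.
pose D k b d := partial i k (fun y => metric_coef g i y b d) (c t).
pose E k b := partial i k (fun y => form_coef a i y ord0 b) (c t).
have F1 l : \sum_b 'D_1 v t ord0 b * metric_coef g i (c t) b l +
    \sum_b \sum_d v t ord0 b * v t ord0 d * D d b l = \sum_d v t ord0 d * E d l.
  exact: dual_along.
have F3 l : \sum_b \sum_d v t ord0 b * v t ord0 d * D l b d =
    2 * \sum_b v t ord0 b * E l b.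
  exact: dual_first_order.
have alg (W X B E1 E2 : R) : W + X = E1 -> B = 2 * E2 -> E1 = E2 ->
    W + (X - 2^-1 * B) = 0.
  by move=> <- -> <-; field.
have F2 l : \sum_d v t ord0 d * E d l = \sum_d v t ord0 d * E l d.
  have := c_dform t (delta_mx ord0 l); rewrite /dform_at mulmx_delta vE mxE => F2.
  apply/eqP; rewrite -subr_eq0 -sumrB -[X in _ == X]F2; apply/eqP.
  by apply: eq_bigr => d _; rewrite mxE mulrBr.
(* [Y] contracts the Christoffel symbols of the first kind twice with [v]. The first two terms
   contribute equally, by exchanging [b] and [d]. *)
pose Y : 'rV[R]_m := \row_l \sum_b \sum_d
  (2^-1 * (D b d l + D d b l - D l b d)) * v t ord0 b * v t ord0 d.
have YE : Y = - ('D_1 v t *m metric_coef g i (c t)).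
  apply/rowP => l; rewrite !mxE; apply/eqP; rewrite -addr_eq0 addrC; apply/eqP.
  have -> : \sum_b \sum_d (2^-1 * (D b d l + D d b l - D l b d)) *
      v t ord0 b * v t ord0 d =
      \sum_b \sum_d v t ord0 b * v t ord0 d * D d b l -
      2^-1 * \sum_b \sum_d v t ord0 b * v t ord0 d * D l b d.
    transitivity (2^-1 * (\sum_b \sum_d v t ord0 b * v t ord0 d * D d b l) +
      2^-1 * (\sum_b \sum_d v t ord0 b * v t ord0 d * D b d l) -
      2^-1 * \sum_b \sum_d v t ord0 b * v t ord0 d * D l b d).
      rewrite -mulrDr -mulrBr -big_split -sumrB mulr_sumr; apply: eq_bigr => b _.
      rewrite -big_split -sumrB mulr_sumr; apply: eq_bigr => d _ /=; ring.
    congr (_ - _).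
    have -> : \sum_b \sum_d v t ord0 b * v t ord0 d * D b d l =
        \sum_b \sum_d v t ord0 b * v t ord0 d * D d b l.
      rewrite exchange_big; apply: eq_bigr => b _; apply: eq_bigr => d _; ring.
    by field.
  exact: alg (F1 l) (F3 l) (F2 l).
have gsym : (invmx (metric_coef g i (c t)))^T = invmx (metric_coef g i (c t)).
  by rewrite trmx_inv (Defs.metric_sym g it).
have YK : Y *m invmx (metric_coef g i (c t)) = - 'D_1 v t.
  exact: opp_mulmxK (metric_coef_unit g it) YE.
apply/rowP => k; rewrite /covariant_acceleration -/i mxE [RHS]mxE wE.
(* The index is raised again by the inverse metric; what remains is to unfold [christoffel] and
   reorder sums. *)
have -> : 'D_1 v t ord0 k = - (Y *m invmx (metric_coef g i (c t))) ord0 k.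
  by rewrite YK mxE opprK.
apply/eqP; rewrite addrC subr_eq0; apply/eqP; rewrite mxE.
transitivity (\sum_b \sum_d \sum_l invmx (metric_coef g i (c t)) k l *
   ((2^-1 * (D b d l + D d b l - D l b d)) * v t ord0 b * v t ord0 d)).
  apply: eq_bigr => b _; apply: eq_bigr => d _.
  rewrite vE /christoffel mulr_sumr !mulr_suml; apply: eq_bigr => l _.
  by rewrite -/(D b d l) -/(D d b l) -/(D l b d); ring.
rewrite exchange_big; under eq_bigr do rewrite exchange_big.
rewrite exchange_big; apply: eq_bigr => l _.
rewrite mxE mulr_suml exchange_big; apply: eq_bigr => b _.
rewrite mulr_suml; apply: eq_bigr => d _.
have -> : invmx (metric_coef g i (c t)) l k = invmx (metric_coef g i (c t)) k l.
  by rewrite -[in RHS]gsym mxE.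
by rewrite mulrC.
Qed.

End Geodesic.

(** * Reparametrized loops *)

Section Reparametrization.
Context (R : realType) (m : nat) (M : topologicalType) (A : smooth_atlas R m M).
Implicit Types (c : R -> M).

(** The two difference quotients are equal as functions of [h], before any limit. *)
Lemma derive_comp_linear (U V W : normedModType R) (L : {linear U -> V})
    (f : V -> W) x v : 'D_v (f \o L) x = 'D_(L v) f (L x).
Proof.
rewrite /derive.
have -> : (fun h => h^-1 *: (((f \o L) \o shift x) (h *: v) - (f \o L) x)) =
    (fun h => h^-1 *: ((f \o shift (L x)) (h *: L v) - f (L x))); last by [].
by apply/funext => h /=; rewrite linearP.
Qed.

Lemma Ck_on_comp_linear (U V W : normedModType R) (L : {linear U -> V}) k
    (P : set V) (f : V -> W) : continuous L ->
  Ck_on k P f -> Ck_on k (L @^-1` P) (f \o L).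
Proof.
move=> cL; elim: k f => [f Cf x Px|k IH f [df Df]].
  by apply: continuous_comp; [exact: cL|exact: Cf].
split=> [x Px|v].
  by apply: differentiable_comp; [exact: linear_differentiable|exact: df].
have -> : 'D_v (f \o L) = 'D_(L v) f \o L; last by apply: IH; exact: Df.
by apply/funext => x; exact: derive_comp_linear.
Qed.

Variable s : R.
Hypothesis s0 : 0 < s.
Let dil : {linear R^o -> R^o} := *:%R s.

Let dil_continuous : continuous dil.
Proof. exact: scaler_continuous. Qed.

Lemma derive_dilation (W : normedModType R) (f : R^o -> W) (t : R) :
  differentiable f (s * t) ->
  'D_1 (fun t => f (s * t)) t = s *: 'D_1 f (s * t).
Proof.
move=> df; rewrite (derive_comp_linear dil f) !deriveE // -linearZ.
by congr ('d f _ _).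
Qed.

Lemma smooth_curve_dilation c : smooth_curve A c -> smooth_curve A (fun t => c (s * t)).
Proof.
move=> [cc Sc]; split=> [t|i k].
  exact: (@continuous_comp R^o R^o M dil c t (@dil_continuous t) (cc _)).
exact: (Ck_on_comp_linear (@dil_continuous) (Sc i k)).
Qed.

Lemma velocity_dilation c t : smooth_curve A c ->
  velocity A (fun t => c (s * t)) t = s *: velocity A c (s * t).
Proof.
move=> Sc; rewrite /velocity !derive1E.
rewrite -(@derive_dilation _ (chart (chart_at A (c (s * t))) \o c)) //.
exact: curve_diff Sc (chart_at_dom A (c (s * t))).
Qed.

Lemma derive1n2_dilation (i : chart_index A) c t : smooth_curve A c -> chart_dom i (c (s * t)) ->
  derive1n 2 (chart i \o (fun t => c (s * t))) t =
  s *: (s *: derive1n 2 (chart i \o c) (s * t)).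
Proof.
move=> Sc it; have [cc Sci] := Sc.
have D2 (f : R -> 'rV[R]_m) r : derive1n 2 f r = 'D_1 ('D_1 (f : R^o -> _)) r.
  rewrite derive1nS derive1n1 derive1E; congr ('D_1 _ r).
  by apply/funext => q; rewrite derive1E.
rewrite !D2.
have dv : differentiable ('D_1 (chart i \o c : R^o -> 'rV[R]_m)) (s * t).
  by have [_ /(_ 1)[dv _]] := Sci i 2; exact: dv.
transitivity ('D_1 (fun t => s *: 'D_1 (chart i \o c : R^o -> 'rV[R]_m) (s * t) : _) (t : R^o)).
  have [cd _] := smooth_curve_dilation Sc.
  apply: near_eq_derive; apply: filterS (near_chart_time cd it) => q iq.
  exact: (@derive_dilation _ (chart i \o c) q (curve_diff Sc iq)).
rewrite deriveZ.
  by congr (_ *: _); exact: derive_dilation.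
apply: diff_derivable.
have ddil : differentiable dil t by exact: linear_differentiable.
exact: (@differentiable_comp R R^o R^o 'rV[R]_m dil
  ('D_1 (chart i \o c : R^o -> 'rV[R]_m)) t ddil dv).
Qed.

(** The second derivative and the Christoffel term, quadratic in the velocity, both scale by
    [s ^+ 2]. *)
Lemma covariant_acceleration_dilation (g : riemannian_metric A) c t :
  smooth_curve A c ->
  covariant_acceleration g (fun t => c (s * t)) t =
  s ^+ 2 *: covariant_acceleration g c (s * t).
Proof.
move=> Sc; apply/rowP => k; rewrite /covariant_acceleration !mxE.
rewrite derive1n2_dilation //; last exact: chart_at_dom.
rewrite velocity_dilation // mulrDr !mxE; congr (_ + _); first by ring.
rewrite mulr_sumr; apply: eq_bigr => b _; rewrite mulr_sumr; apply: eq_bigr => d _.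
by rewrite !mxE; ring.
Qed.

Lemma embedded_loop_dilation P c : embedded_loop A P c ->
  embedded_loop A (P / s) (fun t => c (s * t)).
Proof.
have sn0 : s != 0 by rewrite gt_eqF.
move=> [[P0 Sc per] v0 inj hom]; split.
- split; [by rewrite divr_gt0|exact: smooth_curve_dilation|].
  by move=> t; rewrite mulrDr mulrCA divff // mulr1 per.
- by move=> t; rewrite velocity_dilation // scaler_eq0 negb_or sn0 v0.
- move=> r t /inj[k rt]; exists k; apply: (mulfI sn0); rewrite rt.
  by field.
- move=> t e e0; have := hom (s * t) (s * e) (mulr_gt0 s0 e0).
  apply: filterS => y Hy r /Hy[k rt]; exists k.
  rewrite -(ltr_pM2l s0) -[s in s * `|_|]gtr0_norm // -normrM.
  by rewrite (_ : s * _ = s * r - (s * t + k%:~R * P)) //; field.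
Qed.

(** Rescaled to the unit interval, both loops are the same singular simplex. *)
Lemma null_homologous_dilation P c : null_homologous P c ->
  null_homologous (P / s) (fun t => c (s * t)).
Proof.
rewrite /null_homologous.
have -> // : loop_simplex (P / s) (fun t => c (s * t)) = loop_simplex P c.
apply/funext => x; rewrite /loop_simplex; congr (c _).
by field; rewrite gt_eqF.
Qed.

End Reparametrization.

(** * From dual pairs to the stated properties *)

Section StrongGeodesicLoops.
Context (R : realType) (m : nat) (M : topologicalType) (A : smooth_atlas R m M).
Context (n : nat) (T : 'I_n -> R) (gamma : 'I_n -> R -> M).
Hypothesis n_gt0 : (0 < n)%N.
Hypothesis gamma_emb : forall i, embedded_loop A (T i) (gamma i).
Hypothesis gamma_coor : forall i, coorientable A (T i) (gamma i).
Hypothesis gamma_null : forall i, null_homologous (T i) (gamma i).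
Hypothesis gamma_disj : forall i j s t, gamma i s = gamma j t -> i = j.

(** The norm of [a] is 1 on the loops, so maximality gives the bound 1 on all of [M], from which the
    geodesic equation follows. *)
Lemma dual_pair_strong (g : riemannian_metric A) (a : one_form A) i :
  dual_pair_along gamma g a -> maximal_along g a (gamma i) ->
  strong_geodesic_loop g a (T i) (gamma i).
Proof.
move=> dp maxi; have Sg := gamma_smooth gamma_emb i.
split=> //.
- split=> // t; apply: dual_geodesic Sg _ _ _ _ _ => [r v|r v|r|x].
  + by have [_ _] := dp i r; exact.
  + by have [_ + _] := dp i r; exact.
  + by have [] := dp i r.
  + by rewrite -form_norm_le1 -(dual_pair_norm1 i 0 dp); exact: maxi.
- by move=> t; have [] := dp i t.
- by move=> t; have [] := dp i t.
Qed.

Lemma dual_pair_properties (g : riemannian_metric A) (a : one_form A) :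
  dual_pair_along gamma g a -> (forall i, maximal_along g a (gamma i)) ->
  stated_properties T gamma g a.
Proof.
move=> dp maxg; split=> [i||kappa kappa0].
- exact: dual_pair_strong.
- by exists (T (Ordinal n_gt0)), (gamma (Ordinal n_gt0)); exact: dual_pair_strong.
(* The loops have unit speed, so running them at speed [s] gives energy [s^2 / 2 = kappa]. *)
pose s := Num.sqrt (2 * kappa).
have s0 : 0 < s by rewrite sqrtr_gt0 mulr_gt0.
have sn0 : s != 0 by rewrite gt_eqF.
have s2 : s ^+ 2 = 2 * kappa by rewrite sqr_sqrtr // mulr_ge0 // ltW.
have Sg i := gamma_smooth gamma_emb i.
have metric1 i t : metric_at g (gamma i t) (velocity A (gamma i) t)
    (velocity A (gamma i) t) = 1.
  by have [a1 _ ->] := dp i t.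
have metric_s i t : metric_at g (gamma i (s * t))
    (velocity A (fun t => gamma i (s * t)) t)
    (velocity A (fun t => gamma i (s * t)) t) = s ^+ 2.
  rewrite velocity_dilation // /metric_at -!scalemxAl linearZ /= -scalemxAr scalerA.
  by rewrite mxE -[X in _ * X]/(metric_at g _ _ _) metric1 mulr1.
have form_s i t : form_at a (gamma i (s * t))
    (velocity A (fun t => gamma i (s * t)) t) = s.
  rewrite velocity_dilation // /form_at linearZ /= -scalemxAr mxE.
  by have [a1 _ _] := dp i (s * t); rewrite -[X in _ * X]/(form_at a _ _) a1 mulr1.
exists (fun i => T i / s), (fun i t => gamma i (s * t)); split.
- move=> i; split.
  + split; first exact: smooth_curve_dilation.
    move=> t; rewrite covariant_acceleration_dilation //.
    (* Both sides of the magnetic equation vanish: the loop is a geodesic, and the Lorentz force on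
       its velocity is zero at every speed. *)
    have sg := dual_pair_strong dp (maxg i).
    have [_ ->] := sg_geodesic sg; rewrite scaler0 velocity_dilation //.
    apply/esym; rewrite /lorentz_at -scalemxAl.
    have -> : velocity A (gamma i) (s * t) *m
        dform_coef a (chart_at A (gamma i (s * t))) (gamma i (s * t)) = 0.
      apply/rowP => k; have [_ /(_ (delta_mx ord0 k)) + _] := dp i (s * t).
      by rewrite /dform_at mulmx_delta => ->; rewrite mxE.
    by rewrite scaler0 mul0mx.
  + by move=> t; rewrite metric_s s2 mulKf ?pnatr_eq0.
  + exact: embedded_loop_dilation.
  + exact: null_homologous_dilation.
(* Equal lifted orbits share a point of [M], which by disjointness lies on only one loop. *)
- move=> i j ij.
  have : lifted_orbit A (fun t => gamma i (s * t))
      (gamma i (s * 0), velocity A (fun t => gamma i (s * t)) 0) by exists 0.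
  by rewrite ij => -[t _ [/gamma_disj ->]].
- move=> kappa_c0 i.
  have T0 : 0 < T i := period_gt0 gamma_emb i.
  have le1 x : form_norm g a x <= 1.
    by rewrite -(dual_pair_norm1 i 0 dp); exact: maxg.
  have kappa_half := le_trans kappa_c0 (c0_le_half le1).
  rewrite /action.
  (* The integrand is the constant [s^2 / 2 - s + kappa = s (s - 1)], non-positive because
     [s^2 = 2 kappa <= 1]. *)
  have -> : (fun t => 2^-1 * metric_at g (gamma i (s * t))
      (velocity A (fun t => gamma i (s * t)) t)
      (velocity A (fun t => gamma i (s * t)) t) -
      form_at a (gamma i (s * t)) (velocity A (fun t => gamma i (s * t)) t) + kappa) =
      (fun=> s * (s - 1)).
    by apply/funext => t; rewrite metric_s form_s s2 mulKf ?pnatr_eq0 // mulrBr -expr2 s2; ring.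
  rewrite Rintegral_cst //.
  apply: mulr_le0_ge0; last exact: fine_ge0.
  apply: mulr_ge0_le0; first exact: ltW.
  rewrite subr_le0 -(@ler_pXn2r _ 2) ?nnegrE ?(ltW s0) //.
  by rewrite s2 expr1n; lra.
Qed.

End StrongGeodesicLoops.

Theorem corollary4 (R : realType) (m : nat) (M : topologicalType)
    (A : smooth_atlas R m M) (hM : closed_connected_manifold A)
    (n : nat) (hn : (0 < n)%N) (T : 'I_n -> R) (gamma : 'I_n -> R -> M)
    (gamma_emb : forall i, embedded_loop A (T i) (gamma i))
    (gamma_coor : forall i, coorientable A (T i) (gamma i))
    (gamma_null : forall i, null_homologous (T i) (gamma i))
    (gamma_disj : forall i j s t, gamma i s = gamma j t -> i = j) :
  exists (g : riemannian_metric A) (a : one_form A),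
    stated_properties T gamma g a /\
    forall U : set M, open U -> (forall i t, U (gamma i t)) ->
    forall (g' : riemannian_metric A) (a' : one_form A),
      agree_on U g a g' a' ->
      (forall i, maximal_along g' a' (gamma i)) ->
      stated_properties T gamma g' a'.
Proof.
have [hausM compM _] := hM.
have [g [a [dp le_g]]] := exists_dual_pair hausM compM gamma_emb gamma_disj.
exists g, a; split.
  (* Maximality for the constructed pair: the norm is 1 on the loops, and [alpha^2 <= g] bounds it
     by 1 everywhere. *)
  apply: dual_pair_properties => // i t x.
  by rewrite (dual_pair_norm1 i t dp) form_norm_le1; exact: form_sqnorm_le1.
move=> U oU Ug g' a' agr maxg'; apply: dual_pair_properties => //.
exact: dual_pair_agree oU Ug agr dp.
Qed.
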